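(* Suppose that an equation $\mathcal L$: $u_t=A(t,x)u_{xx}+B(t,x)u_x+C(t,x)u$ (analytic $A,B,C$, $A\ne0$) possesses a Lie symmetry operator $Q=\tau\partial_t+\xi\partial_x+\zeta\partial_u$, where necessarily $\tau=\tau(t)$, $\xi=\xi(t,x)$, $\zeta=\zeta^1(t,x)u+\zeta^0(t,x)$, and additionally $\tau\ne0$. Let $Q_1$ be the associated Lie symmetry operator of the system ${\rm DE}_1(\mathcal L)$, let $(g^1,g^2,g^3)$ be a $Q_1$-invariant solution of ${\rm DE}_1(\mathcal L)$, and let $R=\partial_t+g^1\partial_x+(g^2u+g^3)\partial_u$ be the corresponding reduction operator of $\mathcal L$. Then $g^1,g^2,g^3$ are expressed by the formulas $$g^1=-A\frac{v^1v^2_{xx}-v^1_{xx}v^2}{v^1v^2_x-v^1_xv^2}-B,\quad g^2=-A\frac{v^1_xv^2_{xx}-v^1_{xx}v^2_x}{v^1v^2_x-v^1_xv^2}+C,\quad g^3=\frac{A}{v^1v^2_x-v^1_xv^2}\begin{vmatrix}v^1&v^1_x&v^1_{xx}\\ v^2&v^2_x&v^2_{xx}\\ v^3&v^3_x&v^3_{xx}\end{vmatrix}$$ via a solution $(v^1,v^2,v^3)$, with $v^1,v^2$ linearly independent, of the uncoupled system $3\mathcal L$: $v^i_t=Av^i_{xx}+Bv^i_x+Cv^i$, $i=1,2,3$, which is invariant with respect to the Lie symmetry operator $$\tau\partial_t+\xi\partial_x+\zeta^1v^1\partial_{v^1}+\zeta^1v^2\partial_{v^2}+(\zeta^1v^3+\zeta^0)\partial_{v^3}+\sum_{i=1}^3\sum_{q=1}^2\lambda_{iq}v^q\partial_{v^i}$$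 of this system for some constants $\lambda_{iq}$, $i=1,2,3$, $q=1,2$. Each $R$-invariant solution of $\mathcal L$ is a linear combination, with unit coefficient of $v^3$, of the components of the Lie invariant solution $(v^1,v^2,v^3)$ of $3\mathcal L$.
   Context: All considerations are local: functions are smooth (or analytic) on a suitable domain, which may be shrunk so that expressions not vanishing identically do not vanish. ${\rm DE}_1(\mathcal L)$ is the system for $g^i=g^i(t,x)$, $i=1,2,3$: $$g^1_t-Ag^1_{xx}-Bg^1_x+\Bigl(2g^1_x-\tfrac{A_x}{A}g^1-\tfrac{A_t}{A}\Bigr)(g^1+B)+B_xg^1+2Ag^2_x+B_t=0,$$ $$g^2_t-Ag^2_{xx}-Bg^2_x+\Bigl(2g^1_x-\tfrac{A_x}{A}g^1-\tfrac{A_t}{A}\Bigr)(g^2-C)-C_xg^1-C_t=0,$$ $$g^3_t-Ag^3_{xx}-Bg^3_x+\Bigl(2g^1_x-\tfrac{A_x}{A}g^1-\tfrac{A_t}{A}\Bigr)g^3-Cg^3=0.$$ It is the condition that $R=\partial_t+g^1\partial_x+(g^2u+g^3)\partial_u$ is a reduction operator (nonclassical symmetry) of $\mathcal L$. A function $u$ is $R$-invariant if $u_t+g^1u_x=g^2u+g^3$. The Lie symmetry operator of ${\rm DE}_1(\mathcal L)$ associated with $Q$ is $Q_1=\tau\partial_t+\xi\partial_x+\theta^1\partial_{g^1}+\theta^2\partial_{g^2}+\theta^3\partial_{g^3}$ with $\theta^1=(\xi_x-\tau_t)g^1+\xi_t$, $\theta^2=-\tau_tg^2+\zeta^1_xg^1+\zeta^1_t$,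 $\theta^3=(\zeta^1-\tau_t)g^3-\zeta^0g^2+\zeta^0_xg^1+\zeta^0_t$. *)

(* Defs.v *)
From Stdlib Require Import Reals Factorial.
From Coquelicot Require Import Coquelicot.

Set Implicit Arguments.
Unset Strict Implicit.
Unset Printing Implicit Defensive.

Open Scope R_scope.

(* Functions of (t,x) on a domain D are total functions R -> R -> R of which
   only the values on the open set D matter. *)

Definition open2 (D : R -> R -> Prop) : Prop :=
  forall t x, D t x -> locally_2d D t x.

Definition subdom (U D : R -> R -> Prop) : Prop :=
  forall t x, U t x -> D t x.

Definition box (t0 x0 r : R) : R -> R -> Prop :=
  fun t x => Rabs (t - t0) < r /\ Rabs (x - x0) < r.

Definition dt (f : R -> R -> R) : R -> R -> R :=
  fun t x => Derive (fun s => f s x) t.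

Definition dx (f : R -> R -> R) : R -> R -> R :=
  fun t x => Derive (fun y => f t y) x.

Definition smooth_on (D : R -> R -> Prop) (f : R -> R -> R) : Prop :=
  forall n t x, D t x -> ex_diff_n f n t x.

(* [differential n f t x h k / n!] is the degree n homogeneous part, in (h,k),
   of the Taylor series of f at (t,x). *)
Definition analytic_on (D : R -> R -> Prop) (f : R -> R -> R) : Prop :=
  smooth_on D f /\
  forall t x, D t x -> exists r, 0 < r /\
    forall h k, Rabs h < r -> Rabs k < r ->
      is_series (fun n => differential n f t x h k / INR (fact n))
                (f (t + h) (x + k)).

Definition lin_indep (D : R -> R -> Prop) (f1 f2 : R -> R -> R) : Prop :=
  forall c1 c2 : R,
    (forall t x, D t x -> c1 * f1 t x + c2 * f2 t x = 0) -> c1 = 0 /\ c2 = 0.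

Definition det3 (a b c d e f g h k : R) : R :=
  a * (e * k - f * h) - b * (d * k - f * g) + c * (d * h - e * g).

(* The dependent variables are indexed by a type I. *)

Record jet2 (I : Type) := Jet2 {
  jt : R;
  jx : R;
  jw : I -> R;
  jw_t : I -> R;
  jw_x : I -> R;
  jw_tt : I -> R;
  jw_tx : I -> R;
  jw_xx : I -> R
}.

Definition jet (I : Type) (w : I -> R -> R -> R) (t x : R) : jet2 I :=
  Jet2 t x
    (fun i => w i t x)
    (fun i => dt (w i) t x)
    (fun i => dx (w i) t x)
    (fun i => dt (dt (w i)) t x)
    (fun i => dt (dx (w i)) t x)
    (fun i => dx (dx (w i)) t x).

(* A second-order system  Delta k (t, x, w, w_t, ..., w_xx) = 0,  k : K. *)
Definition solves (I K : Type) (D : R -> R -> Prop)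
    (Delta : K -> jet2 I -> R) (w : I -> R -> R -> R) : Prop :=
  forall t x, D t x -> forall k, Delta k (jet w t x) = 0.

(* The vector field  vt d/dt + vx d/dx + sum_i vw_i d/dw^i,  whose coefficients
   are functions of (t,x,w). *)
Record vfield (I : Type) := VField {
  vt : R -> R -> (I -> R) -> R;
  vx : R -> R -> (I -> R) -> R;
  vw : I -> R -> R -> (I -> R) -> R
}.

Definition along (I : Type) (w : I -> R -> R -> R)
    (F : R -> R -> (I -> R) -> R) : R -> R -> R :=
  fun t x => F t x (fun i => w i t x).

Definition invariant (I : Type) (D : R -> R -> Prop) (X : vfield I)
    (w : I -> R -> R -> R) : Prop :=
  forall t x, D t x -> forall i,
    along w (vt X) t x * dt (w i) t x + along w (vx X) t x * dx (w i) t x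
    = along w (vw X i) t x.

Definition characteristic (I : Type) (X : vfield I) (w : I -> R -> R -> R)
    (i : I) : R -> R -> R :=
  fun t x =>
    along w (vw X i) t x
    - along w (vt X) t x * dt (w i) t x - along w (vx X) t x * dx (w i) t x.

(* The second prolongation of X at the 2-jet of w at (t,x): the coefficient of
   d/dw^i_J is  D_J(Q^i) + vt D_J(w^i_t) + vx D_J(w^i_x),  with Q the
   characteristic and D_J the total derivative, i.e. the partial derivative of
   the function of (t,x) obtained by substituting w.  The third-order
   derivatives of w cancel. *)
Definition prolong (I : Type) (X : vfield I) (w : I -> R -> R -> R)
    (t x : R) : jet2 I :=
  let a := along w (vt X) t x in
  let b := along w (vx X) t x in
  let Q := characteristic X w in
  Jet2 a b
    (fun i => along w (vw X i) t x)
    (fun i => dt (Q i) t x + a * dt (dt (w i)) t x + b * dt (dx (w i)) t x)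
    (fun i => dx (Q i) t x + a * dt (dx (w i)) t x + b * dx (dx (w i)) t x)
    (fun i => dt (dt (Q i)) t x
              + a * dt (dt (dt (w i))) t x + b * dt (dt (dx (w i))) t x)
    (fun i => dt (dx (Q i)) t x
              + a * dt (dt (dx (w i))) t x + b * dt (dx (dx (w i))) t x)
    (fun i => dx (dx (Q i)) t x
              + a * dt (dx (dx (w i))) t x + b * dx (dx (dx (w i))) t x).

Definition jet_shift (I : Type) (j : jet2 I) (e : R) (p : jet2 I) : jet2 I :=
  Jet2 (jt j + e * jt p) (jx j + e * jx p)
    (fun i => jw j i + e * jw p i)
    (fun i => jw_t j i + e * jw_t p i)
    (fun i => jw_x j i + e * jw_x p i)
    (fun i => jw_tt j i + e * jw_tt p i)
    (fun i => jw_tx j i + e * jw_tx p i)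
    (fun i => jw_xx j i + e * jw_xx p i).

(* Infinitesimal invariance criterion: pr^(2) X (Delta) = 0 at every 2-jet over
   D satisfying Delta = 0.  Jets are represented by functions w, which need to
   satisfy the system at the point (t,x) only; the action of pr^(2) X on
   Delta k is a directional derivative. *)
Definition lie_symmetry (I K : Type) (D : R -> R -> Prop)
    (Delta : K -> jet2 I -> R) (X : vfield I) : Prop :=
  forall (U : R -> R -> Prop) (w : I -> R -> R -> R),
    open2 U -> subdom U D -> (forall i, smooth_on U (w i)) ->
    forall t x, U t x ->
      (forall k, Delta k (jet w t x) = 0) ->
      forall k,
        is_derive
          (fun e : R => Delta k (jet_shift (jet w t x) e (prolong X w t x)))
          0 0.

(* w^i_t = A w^i_xx + B w^i_x + C w^i  for each i : I; the single equation L is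
   the case I = unit. *)
Definition uncoupled (I : Type) (A B C : R -> R -> R) : I -> jet2 I -> R :=
  fun i j =>
    jw_t j i
    - (A (jt j) (jx j) * jw_xx j i + B (jt j) (jx j) * jw_x j i
       + C (jt j) (jx j) * jw j i).

Definition single (u : R -> R -> R) : unit -> R -> R -> R := fun _ => u.

Inductive idx3 := i1 | i2 | i3.

Definition DE1 (A B C : R -> R -> R) : idx3 -> jet2 idx3 -> R :=
  fun k j =>
    let a := A (jt j) (jx j) in
    let b := B (jt j) (jx j) in
    let c := C (jt j) (jx j) in
    let a_t := dt A (jt j) (jx j) in
    let a_x := dx A (jt j) (jx j) in
    let b_t := dt B (jt j) (jx j) in
    let b_x := dx B (jt j) (jx j) in
    let c_t := dt C (jt j) (jx j) in
    let c_x := dx C (jt j) (jx j) in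
    let g := jw j in
    let g_t := jw_t j in
    let g_x := jw_x j in
    let g_xx := jw_xx j in
    let K := 2 * g_x i1 - a_x / a * g i1 - a_t / a in
    match k with
    | i1 => g_t i1 - a * g_xx i1 - b * g_x i1 + K * (g i1 + b)
            + b_x * g i1 + 2 * a * g_x i2 + b_t
    | i2 => g_t i2 - a * g_xx i2 - b * g_x i2 + K * (g i2 - c)
            - c_x * g i1 - c_t
    | i3 => g_t i3 - a * g_xx i3 - b * g_x i3 + K * g i3 - c * g i3
    end.

Definition Qop (tau : R -> R) (xi zeta1 zeta0 : R -> R -> R) : vfield unit :=
  VField (fun t _ _ => tau t) (fun t x _ => xi t x)
    (fun _ t x u => zeta1 t x * u tt + zeta0 t x).

Definition Q1op (tau : R -> R) (xi zeta1 zeta0 : R -> R -> R) : vfield idx3 :=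
  VField (fun t _ _ => tau t) (fun t x _ => xi t x)
    (fun i t x g =>
       match i with
       | i1 => (dx xi t x - Derive tau t) * g i1 + dt xi t x
       | i2 => - Derive tau t * g i2 + dx zeta1 t x * g i1 + dt zeta1 t x
       | i3 => (zeta1 t x - Derive tau t) * g i3 - zeta0 t x * g i2
               + dx zeta0 t x * g i1 + dt zeta0 t x
       end).

Definition Rop (g : idx3 -> R -> R -> R) : vfield unit :=
  VField (fun _ _ _ => 1) (fun t x _ => g i1 t x)
    (fun _ t x u => g i2 t x * u tt + g i3 t x).

(* lam1 i, lam2 i stand for lambda_{i1}, lambda_{i2}. *)
Definition Q3op (tau : R -> R) (xi zeta1 zeta0 : R -> R -> R)
    (lam1 lam2 : idx3 -> R) : vfield idx3 :=
  VField (fun t _ _ => tau t) (fun t x _ => xi t x)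
    (fun i t x v =>
       zeta1 t x * v i + match i with i3 => zeta0 t x | _ => 0 end
       + (lam1 i * v i1 + lam2 i * v i2)).

(* Main.v *)
(** A function is R-invariant and solves L iff it solves u_t + g^1 u_x = g^2 u + g^3 and
    A u_xx = -(B + g^1) u_x + (g^2 - C) u + g^3.  Written for (u, u_x), this is a
    linear total differential system, whose compatibility condition is DE_1(L); by
    the Frobenius theorem its solutions form a two-dimensional affine space, and
    v^1, v^2 (a basis of solutions of the homogeneous system) and v^3 (a particular
    solution) give the formulas for g^1, g^2, g^3 by Cramer's rule.  The Lie symmetry
    Q maps solutions of L to solutions, and Q_1-invariance of g makes
    tau d_t + xi d_x - zeta^1 commute with d_t + g^1 d_x - g^2 up to the factor -tau';
    hence the characteristic of Q on each v^i solves the homogeneous system, so it is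
    a constant combination of v^1, v^2, which yields the lambda_iq. *)

Require Import Defs.
From Stdlib Require Import Reals Lra Lia ClassicalEpsilon.
From Coquelicot Require Import Coquelicot.

Set Bullet Behavior "Strict Subproofs".

(** * Linear ordinary differential equations *)

(** The Frobenius theorem is proved quantitatively, on one box where the coefficients are bounded by
    [K] and [4 * r * K <= 1]. This inequality is both the contraction constant of the Picard
    iteration and the absorption constant that stands in for Gronwall's exponential. Solving in [t]
    along [x = x0] and then in [x] for each fixed [t] leaves only the [t]-equations off the axis.
    There the candidate for the [t]-derivative is the right-hand side itself: compatibility says
    that it solves the [x]-equation differentiated formally in [t], so the first-order Taylor error
    in [t] solves that equation up to a term quadratic in the increment. Since the system is affine,
    the box does not depend on the initial values, and one box serves a whole basis. Coefficients
    over a basis are constant by Liouville's formula: all Wronskians obey the same first-order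
    equations, so their ratios are constant. The inhomogeneous term zeta^0 has to be separated from
    the linear part of Q; it is itself a solution of L (take the characteristic on u = 0), so it can
    be kept for v^3 and dropped for v^1 and v^2. *)

Lemma between_center (x0 x y r : R) :
  Rabs (x - x0) < r -> Rmin x0 x <= y <= Rmax x0 x -> Rabs (y - x0) < r.
Proof.
  intros H [H1 H2].
  unfold Rmin, Rmax in *; destruct (Rle_dec x0 x);
    unfold Rabs in *; repeat destruct Rcase_abs in *; lra.
Qed.

Lemma locally_center (x0 x r : R) :
  Rabs (x - x0) < r -> locally x (fun y => Rabs (y - x0) < r).
Proof.
  intros H.
  assert (Hd : 0 < r - Rabs (x - x0)) by lra.
  exists (mkposreal _ Hd); intros y Hy.
  unfold ball in Hy; simpl in Hy; unfold AbsRing_ball, abs, minus, plus, opp in Hy;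
    simpl in Hy.
  replace (y - x0) with ((y + - x) + (x - x0)) by ring.
  eapply Rle_lt_trans; [apply Rabs_triang | lra].
Qed.

(** The mean value inequality, with the endpoints in either order; it drives the Picard, growth and
    Taylor estimates below. *)
Lemma is_derive_bounded_variation (f df : R -> R) (a b M : R) :
  (forall x, Rmin a b <= x <= Rmax a b -> is_derive f x (df x)) ->
  (forall x, Rmin a b <= x <= Rmax a b -> Rabs (df x) <= M) ->
  Rabs (f b - f a) <= M * Rabs (b - a).
Proof.
  intros Hd HM.
  destruct (MVT_gen f a b df) as [c [Hc Heq]].
  - intros x Hx; apply Hd; lra.
  - intros x Hx; apply continuity_pt_filterlim.
    apply (ex_derive_continuous (V := R_NormedModule)); exists (df x); now apply Hd.
  - rewrite Heq, Rabs_mult.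
    apply Rmult_le_compat_r; [apply Rabs_pos | now apply HM].
Qed.

Fixpoint picard (f1 f2 : R -> R -> R -> R) (x0 u0 p0 : R) (n : nat) : R -> R * R :=
  match n with
  | O => fun _ => (u0, p0)
  | S n => fun x =>
      let w := picard f1 f2 x0 u0 p0 n in
      (u0 + RInt (fun s => f1 s (fst (w s)) (snd (w s))) x0 x,
       p0 + RInt (fun s => f2 s (fst (w s)) (snd (w s))) x0 x)
  end.

Lemma is_derive_RInt_center (f : R -> R) (x0 r c x : R) :
  (forall y, Rabs (y - x0) < r -> continuous f y) ->
  Rabs (x - x0) < r -> is_derive (fun y => c + RInt f x0 y) x (f x).
Proof.
  intros Hc Hx.
  replace (f x) with (0 + f x) by ring.
  apply (is_derive_plus (V := R_NormedModule)); [apply @is_derive_const|].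
  apply (is_derive_RInt f _ x0); [|now apply Hc].
  generalize (locally_center _ _ _ Hx); apply filter_imp; intros y Hy.
  apply (RInt_correct (V := R_CompleteNormedModule)),
    (ex_RInt_continuous (V := R_CompleteNormedModule)).
  intros z Hz; apply Hc; eapply between_center; eauto.
Qed.

(** The Lipschitz bound is global in the unknowns, so the iterates need no confinement to a ball and
    the solution lives on the whole interval. Continuity of the right-hand sides is required along
    continuous curves, the form in which the Picard integrals use it. *)
Lemma picard_lindelof (f1 f2 : R -> R -> R -> R) (x0 r K M u0 p0 : R) :
  0 < r -> 0 <= K -> 4 * r * K <= 1 ->
  (forall x u p u' p', Rabs (x - x0) < r ->
     Rabs (f1 x u p - f1 x u' p') <= K * (Rabs (u - u') + Rabs (p - p')) /\
     Rabs (f2 x u p - f2 x u' p') <= K * (Rabs (u - u') + Rabs (p - p'))) ->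
  (forall x, Rabs (x - x0) < r ->
     Rabs (f1 x u0 p0) <= M /\ Rabs (f2 x u0 p0) <= M) ->
  (forall (u p : R -> R) x, Rabs (x - x0) < r ->
     continuous u x -> continuous p x ->
     continuous (fun s => f1 s (u s) (p s)) x /\
     continuous (fun s => f2 s (u s) (p s)) x) ->
  exists u p : R -> R, u x0 = u0 /\ p x0 = p0 /\
    forall x, Rabs (x - x0) < r ->
      is_derive u x (f1 x (u x) (p x)) /\ is_derive p x (f2 x (u x) (p x)).
Proof.
  intros Hr HK HrK Hlip HM Hcont.
  set (P := picard f1 f2 x0 u0 p0).
  set (un := fun n x => fst (P n x)).
  set (pn := fun n x => snd (P n x)).
  assert (Hinit : forall n, un n x0 = u0 /\ pn n x0 = p0).
  { intros [|n]; unfold un, pn, P; simpl; [easy|].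
    rewrite !RInt_point; unfold zero; simpl; split; ring. }
  assert (Hcn : forall n x, Rabs (x - x0) < r ->
            continuous (un n) x /\ continuous (pn n) x /\
            is_derive (un (S n)) x (f1 x (un n x) (pn n x)) /\
            is_derive (pn (S n)) x (f2 x (un n x) (pn n x))).
  { assert (Hstep : forall n,
              (forall x, Rabs (x - x0) < r ->
                 continuous (un n) x /\ continuous (pn n) x) ->
              forall x, Rabs (x - x0) < r ->
              is_derive (un (S n)) x (f1 x (un n x) (pn n x)) /\
              is_derive (pn (S n)) x (f2 x (un n x) (pn n x))).
    { intros n Hn x Hx; split.
      - apply (is_derive_RInt_center (fun s => f1 s (un n s) (pn n s)) x0 r u0); auto.
        intros y Hy; apply Hcont; auto; now apply Hn.
      - apply (is_derive_RInt_center (fun s => f2 s (un n s) (pn n s)) x0 r p0); auto.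
        intros y Hy; apply Hcont; auto; now apply Hn. }
    assert (Hc : forall n x, Rabs (x - x0) < r ->
              continuous (un n) x /\ continuous (pn n) x).
    { induction n as [|n IH]; intros x Hx.
      - split; apply continuous_const.
      - destruct (Hstep n IH x Hx) as [H1 H2].
        split; apply (ex_derive_continuous (V := R_NormedModule)); eexists; eauto. }
    intros n x Hx; destruct (Hc n x Hx); destruct (Hstep n (Hc n) x Hx); auto. }
  assert (HM0 : 0 <= M).
  { destruct (HM x0) as [H _].
    - rewrite Rminus_diag, Rabs_R0; auto.
    - eapply Rle_trans; [apply Rabs_pos | exact H]. }
  (* Consecutive iterates contract by one half: each component of the next difference is at most
     [K * e * r], and the sum [2 * K * e * r] is at most [e / 2] by [4 * r * K <= 1]. *)
  assert (Hdiff : forall n x, Rabs (x - x0) < r ->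
            Rabs (un (S n) x - un n x) + Rabs (pn (S n) x - pn n x)
            <= 2 * r * M * (1 / 2) ^ n).
  { induction n as [|n IH]; intros x Hx.
    - assert (H1 : Rabs (un 1%nat x - u0) <= M * Rabs (x - x0)).
      { rewrite <- (proj1 (Hinit 1%nat)).
        apply is_derive_bounded_variation with (fun y => f1 y u0 p0).
        - intros y Hy; apply (Hcn 0%nat); eapply between_center; eauto.
        - intros y Hy; apply HM; eapply between_center; eauto. }
      assert (H2 : Rabs (pn 1%nat x - p0) <= M * Rabs (x - x0)).
      { rewrite <- (proj2 (Hinit 1%nat)).
        apply is_derive_bounded_variation with (fun y => f2 y u0 p0).
        - intros y Hy; apply (Hcn 0%nat); eapply between_center; eauto.
        - intros y Hy; apply HM; eapply between_center; eauto. }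
      change (un 0%nat x) with u0; change (pn 0%nat x) with p0.
      simpl pow; nra.
    - set (e := 2 * r * M * (1 / 2) ^ n) in *.
      assert (He : 0 <= e).
      { eapply Rle_trans; [|apply (IH x0)].
        - apply Rplus_le_le_0_compat; apply Rabs_pos.
        - rewrite Rminus_diag, Rabs_R0; auto. }
      assert (H1 : Rabs ((un (S (S n)) x - un (S n) x)
                   - (un (S (S n)) x0 - un (S n) x0)) <= K * e * Rabs (x - x0)).
      { apply (is_derive_bounded_variation (fun y => un (S (S n)) y - un (S n) y)
           (fun y => f1 y (un (S n) y) (pn (S n) y) - f1 y (un n y) (pn n y))).
        - intros y Hy; apply (is_derive_minus (V := R_NormedModule));
            apply Hcn; eapply between_center; eauto.
        - intros y Hy; assert (Hy' := between_center _ _ _ _ Hx Hy).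
          eapply Rle_trans; [apply Hlip; auto|].
          apply Rmult_le_compat_l; auto. }
      assert (H2 : Rabs ((pn (S (S n)) x - pn (S n) x)
                   - (pn (S (S n)) x0 - pn (S n) x0)) <= K * e * Rabs (x - x0)).
      { apply (is_derive_bounded_variation (fun y => pn (S (S n)) y - pn (S n) y)
           (fun y => f2 y (un (S n) y) (pn (S n) y) - f2 y (un n y) (pn n y))).
        - intros y Hy; apply (is_derive_minus (V := R_NormedModule));
            apply Hcn; eapply between_center; eauto.
        - intros y Hy; assert (Hy' := between_center _ _ _ _ Hx Hy).
          eapply Rle_trans; [apply Hlip; auto|].
          apply Rmult_le_compat_l; auto. }
      rewrite !(proj1 (Hinit _)), Rminus_diag, Rminus_0_r in H1.
      rewrite !(proj2 (Hinit _)), Rminus_diag, Rminus_0_r in H2.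
      assert (HKe : 0 <= K * e) by (apply Rmult_le_pos; auto).
      assert (K * e * Rabs (x - x0) <= K * e * r) by (apply Rmult_le_compat_l; lra).
      replace (2 * r * M * (1 / 2) ^ S n) with (e / 2) by (unfold e; simpl; field).
      nra. }
  (* A telescoping geometric sum; the factor [1 - (1 / 2) ^ k] is the exact partial sum, which lets
     the induction on [k] close. *)
  assert (Hcau : forall n k x, Rabs (x - x0) < r ->
            Rabs (un (n + k)%nat x - un n x) + Rabs (pn (n + k)%nat x - pn n x)
            <= 4 * r * M * (1 / 2) ^ n * (1 - (1 / 2) ^ k)).
  { intros n k x Hx; induction k as [|k IH].
    - rewrite Nat.add_0_r, !Rminus_diag, Rabs_R0; simpl; lra.
    - replace (n + S k)%nat with (S (n + k)) by lia.
      assert (H := Hdiff (n + k)%nat x Hx).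
      assert (H1 := Rabs_triang (un (S (n + k)) x - un (n + k)%nat x)
                      (un (n + k)%nat x - un n x)).
      assert (H2 := Rabs_triang (pn (S (n + k)) x - pn (n + k)%nat x)
                      (pn (n + k)%nat x - pn n x)).
      replace (un (S (n + k)) x - un (n + k)%nat x + (un (n + k)%nat x - un n x))
        with (un (S (n + k)) x - un n x) in H1 by ring.
      replace (pn (S (n + k)) x - pn (n + k)%nat x + (pn (n + k)%nat x - pn n x))
        with (pn (S (n + k)) x - pn n x) in H2 by ring.
      rewrite pow_add in H.
      change ((1 / 2) ^ S k) with (1 / 2 * (1 / 2) ^ k).
      lra. }
  assert (Hsmall : forall eps : posreal, exists N, forall n m x, Rabs (x - x0) < r ->
            (N <= n)%nat -> (N <= m)%nat ->
            Rabs (un n x - un m x) + Rabs (pn n x - pn m x) < eps).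
  { intros eps.
    destruct (pow_lt_1_zero (1 / 2)) with (y := eps / (4 * r * M + 1)) as [N HN].
    - rewrite Rabs_pos_eq; lra.
    - apply Rdiv_lt_0_compat; [apply cond_pos | nra].
    - exists N.
      assert (Hlt : forall n m x, Rabs (x - x0) < r -> (N <= n)%nat -> (n <= m)%nat ->
            Rabs (un m x - un n x) + Rabs (pn m x - pn n x) < eps).
      { intros n m x Hx Hn Hm.
        specialize (HN n Hn); rewrite Rabs_pos_eq in HN by (apply pow_le; lra).
        assert (H := Hcau n (m - n)%nat x Hx).
        replace (n + (m - n))%nat with m in H by lia.
        assert (0 < (1 / 2) ^ (m - n)) by (apply pow_lt; lra).
        assert (0 < (1 / 2) ^ n) by (apply pow_lt; lra).
        assert (0 <= r * M) by nra.
        assert ((1 / 2) ^ n * (4 * r * M + 1) < eps).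
        { apply Rmult_lt_compat_r with (r := 4 * r * M + 1) in HN; [|nra].
          replace (eps / (4 * r * M + 1) * (4 * r * M + 1)) with (pos eps) in HN
            by (field; nra).
          exact HN. }
        eapply Rle_lt_trans; [exact H|].
        eapply Rle_lt_trans; [|eassumption].
        assert (0 <= 4 * (r * M) * (1 / 2) ^ n) by (apply Rmult_le_pos; lra).
        nra. }
      intros n m x Hx Hn Hm.
      destruct (Nat.le_gt_cases n m).
      + rewrite (Rabs_minus_sym (un n x)), (Rabs_minus_sym (pn n x)); auto.
      + apply Hlt; auto; lia. }
  set (D := fun x => Rabs (x - x0) < r).
  assert (HDo : open D) by (intros x Hx; now apply locally_center).
  assert (HDc : is_connected D).
  { intros a b x Ha Hb Hx; unfold D, Rabs in *;
      repeat destruct Rcase_abs in *; lra. }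
  assert (Hu : CVU_dom un D).
  { apply CVU_dom_cauchy; intros eps; destruct (Hsmall eps) as [N HN].
    exists N; intros n m x Hx Hn Hm; specialize (HN n m x Hx Hn Hm).
    assert (H := Rabs_pos (pn n x - pn m x)); lra. }
  assert (Hp : CVU_dom pn D).
  { apply CVU_dom_cauchy; intros eps; destruct (Hsmall eps) as [N HN].
    exists N; intros n m x Hx Hn Hm; specialize (HN n m x Hx Hn Hm).
    assert (H := Rabs_pos (un n x - un m x)); lra. }
  set (u := fun x => real (Lim_seq (fun n => un n x))).
  set (p := fun x => real (Lim_seq (fun n => pn n x))).
  assert (Hlim : forall (F : R -> R -> R -> R) x, D x ->
     (forall u p u' p', Rabs (F x u p - F x u' p')
                        <= K * (Rabs (u - u') + Rabs (p - p'))) ->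
     is_lim_seq (fun n => F x (un n x) (pn n x)) (F x (u x) (p x))).
  { intros F x Hx HF; apply is_lim_seq_spec; intros eps.
    assert (He : 0 < eps / (2 * (K + 1))) by
      (apply Rdiv_lt_0_compat; [apply cond_pos | lra]).
    destruct (Hu (mkposreal _ He)) as [N1 HN1].
    destruct (Hp (mkposreal _ He)) as [N2 HN2].
    exists (max N1 N2); intros n Hn.
    specialize (HN1 n ltac:(lia) x Hx); specialize (HN2 n ltac:(lia) x Hx).
    simpl in HN1, HN2.
    eapply Rle_lt_trans; [apply HF|].
    fold (u x) in HN1; fold (p x) in HN2.
    set (e := eps / (2 * (K + 1))) in *.
    replace (pos eps) with ((K + 1) * (e + e)) by (unfold e; field; lra).
    apply Rle_lt_trans with (K * (e + e)); [apply Rmult_le_compat_l; lra | nra]. }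
  (* The limit is differentiated by uniform convergence of derivatives. The sequence is shifted by
     one because the derivative of iterate [S n] is the right-hand side at iterate [n]; the limit is
     unchanged. *)
  assert (HDer : forall (F : R -> R -> R -> R) (wn : nat -> R -> R),
     CVU_dom wn D ->
     (forall n x, D x -> continuous (wn n) x) ->
     (forall n x, D x -> is_derive (wn (S n)) x (F x (un n x) (pn n x))) ->
     (forall n x, D x -> continuous (fun s => F s (un n s) (pn n s)) x) ->
     (forall x u p u' p', D x -> Rabs (F x u p - F x u' p')
                        <= K * (Rabs (u - u') + Rabs (p - p'))) ->
     forall x, D x ->
       is_derive (fun y => real (Lim_seq (fun n => wn n y))) x (F x (u x) (p x))).
  { intros F wn Hw Hwc Hwd HFc HF x Hx.
    assert (HDw : forall n y, D y -> Derive (wn (S n)) y = F y (un n y) (pn n y)).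
    { intros n y Hy; apply is_derive_unique; auto. }
    replace (F x (u x) (p x))
      with (real (Lim_seq (fun n => Derive (wn (S n)) x))).
    2:{ rewrite (Lim_seq_ext _ (fun n => F x (un n x) (pn n x)))
          by (intros n; now apply HDw).
        rewrite (is_lim_seq_unique _ _ (Hlim F x Hx (fun a b c d => HF x a b c d Hx))).
        reflexivity. }
    apply is_derive_ext with (fun y => real (Lim_seq (fun n => wn (S n) y))).
    { intros y; now rewrite (Lim_seq_incr_1 (fun n => wn n y)). }
    apply (CVU_Derive (fun n => wn (S n)) D); auto.
    - intros eps; destruct (Hw eps) as [N HN]; exists N; intros n Hn y Hy.
      rewrite (Lim_seq_incr_1 (fun n => wn n y)); apply HN; auto.
    - intros n y Hy; eexists; eauto.
    - intros n y Hy; apply continuity_pt_filterlim.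
      apply (continuous_ext_loc _ (fun s => F s (un n s) (pn n s))); [|auto].
      generalize (HDo y Hy); apply filter_imp; intros z Hz; symmetry; auto.
    - apply CVU_dom_cauchy; intros eps.
      assert (He : 0 < eps / (K + 1)) by
        (apply Rdiv_lt_0_compat; [apply cond_pos | lra]).
      destruct (Hsmall (mkposreal _ He)) as [N HN]; simpl in HN.
      exists N; intros n m y Hy Hn Hm; rewrite !HDw by auto.
      eapply Rle_lt_trans; [apply HF; auto|].
      specialize (HN n m y Hy Hn Hm).
      set (e := eps / (K + 1)) in *.
      replace (pos eps) with ((K + 1) * e) by (unfold e; field; lra).
      apply Rle_lt_trans with (K * e); [apply Rmult_le_compat_l; lra | nra]. }
  exists u, p; split; [|split].
  - unfold u; rewrite (Lim_seq_ext _ (fun _ => u0)) by (intros n; apply Hinit).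
    now rewrite Lim_seq_const.
  - unfold p; rewrite (Lim_seq_ext _ (fun _ => p0)) by (intros n; apply Hinit).
    now rewrite Lim_seq_const.
  - intros x Hx; split.
    + apply (HDer f1 un); auto.
      * intros n y Hy; now apply Hcn.
      * intros n y Hy; now apply Hcn.
      * intros n y Hy; apply Hcont; auto; now apply Hcn.
      * intros; now apply Hlip.
    + apply (HDer f2 pn); auto.
      * intros n y Hy; now apply Hcn.
      * intros n y Hy; now apply Hcn.
      * intros n y Hy; apply Hcont; auto; now apply Hcn.
      * intros; now apply Hlip.
Qed.

(** A Gronwall estimate without exponentials. If [M] is the maximum of [|d| + |e|] on the segment,
    integrating from [x0] gives [M <= 2 * delta + 2 * (K * M + eps) * |x - x0|], and
    [4 * |x - x0| * K <= 1] absorbs half of [M] into the left side. *)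
Lemma planar_growth (d e d' e' : R -> R) (x0 x K delta eps : R) :
  0 <= K -> 0 <= eps -> 4 * Rabs (x - x0) * K <= 1 ->
  (forall y, Rmin x0 x <= y <= Rmax x0 x ->
     is_derive d y (d' y) /\ is_derive e y (e' y) /\
     Rabs (d' y) <= K * (Rabs (d y) + Rabs (e y)) + eps /\
     Rabs (e' y) <= K * (Rabs (d y) + Rabs (e y)) + eps) ->
  Rabs (d x0) <= delta -> Rabs (e x0) <= delta ->
  Rabs (d x) + Rabs (e x) <= 4 * delta + 4 * Rabs (x - x0) * eps.
Proof.
  intros HK He HxK Hd Hd0 He0.
  destruct (continuity_ab_maj (fun y => Rabs (d y) + Rabs (e y)) (Rmin x0 x) (Rmax x0 x))
    as [y [Hmax Hy]].
  - apply Rminmax.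
  - intros y Hy; destruct (Hd y Hy) as [H1 [H2 _]].
    apply continuity_pt_filterlim.
    assert (HC : forall (f : R -> R) l, is_derive f y l -> continuous (fun z => Rabs (f z)) y).
    { intros f l Hf; apply (continuous_comp f Rabs); [|apply continuous_Rabs].
      apply (ex_derive_continuous (V := R_NormedModule)); now exists l. }
    apply (continuous_plus (V := R_NormedModule) (fun z => Rabs (d z)) (fun z => Rabs (e z)));
      eapply HC; eassumption.
  - set (M := Rabs (d y) + Rabs (e y)) in *.
    assert (Hsub : forall z, Rmin x0 y <= z <= Rmax x0 y -> Rmin x0 x <= z <= Rmax x0 x).
    { intros z; revert Hy; unfold Rmin, Rmax.
      repeat destruct Rle_dec; lra. }
    assert (Hyx : Rabs (y - x0) <= Rabs (x - x0)).
    { revert Hy; unfold Rmin, Rmax, Rabs.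
      repeat destruct Rle_dec; repeat destruct Rcase_abs; lra. }
    assert (HM : 0 <= M) by (apply Rplus_le_le_0_compat; apply Rabs_pos).
    assert (Hgen : forall f f' : R -> R,
       (forall z, Rmin x0 x <= z <= Rmax x0 x -> is_derive f z (f' z) /\
          Rabs (f' z) <= K * (Rabs (d z) + Rabs (e z)) + eps) ->
       Rabs (f x0) <= delta ->
       Rabs (f y) <= delta + (K * M + eps) * Rabs (x - x0)).
    { intros f f' Hf Hf0.
      assert (H : Rabs (f y - f x0) <= (K * M + eps) * Rabs (y - x0)).
      { apply is_derive_bounded_variation with f'.
        - intros z Hz; apply Hf; auto.
        - intros z Hz; eapply Rle_trans; [apply Hf; auto|].
          apply Rplus_le_compat_r, Rmult_le_compat_l; auto. }
      assert (H2 := Rabs_triang (f y - f x0) (f x0)).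
      replace (f y - f x0 + f x0) with (f y) in H2 by ring.
      assert (0 <= K * M) by (apply Rmult_le_pos; auto).
      assert ((K * M + eps) * Rabs (y - x0) <= (K * M + eps) * Rabs (x - x0))
        by (apply Rmult_le_compat_l; lra).
      lra. }
    assert (H1 := Hgen d d' (fun z Hz => conj (proj1 (Hd z Hz))
                    (proj1 (proj2 (proj2 (Hd z Hz))))) Hd0).
    assert (H2 := Hgen e e' (fun z Hz => conj (proj1 (proj2 (Hd z Hz)))
                    (proj2 (proj2 (proj2 (Hd z Hz))))) He0).
    assert (Hx : Rabs (d x) + Rabs (e x) <= M).
    { apply Hmax; unfold Rmin, Rmax; destruct Rle_dec; lra. }
    assert (Hfin : M <= 2 * delta + 2 * (K * M + eps) * Rabs (x - x0)).
    { unfold M at 1; lra. }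
    nra.
Qed.

(** Clearing the denominator of the difference quotient admits [y = x] and gives the form in which
    [frobenius] bounds its errors. *)
Lemma is_derive_error (f : R -> R) (x l : R) :
  is_derive f x l <->
  forall eps, 0 < eps -> exists delta, 0 < delta /\
    forall y, Rabs (y - x) < delta -> Rabs (f y - f x - (y - x) * l) <= eps * Rabs (y - x).
Proof.
  rewrite is_derive_Reals; split.
  - intros H eps He; destruct (H eps He) as [delta Hd].
    exists delta; split; [apply cond_pos|]; intros y Hy.
    destruct (Req_dec (y - x) 0) as [E | E].
    + replace y with x by lra; rewrite !Rminus_diag, Rmult_0_l, Rminus_0_r, Rabs_R0; lra.
    + specialize (Hd (y - x) E Hy).
      replace (x + (y - x)) with y in Hd by ring.
      replace (f y - f x - (y - x) * l) with (((f y - f x) / (y - x) - l) * (y - x))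
        by (field; auto).
      rewrite Rabs_mult; apply Rmult_le_compat_r; [apply Rabs_pos | lra].
  - intros H eps He; destruct (H (eps / 2) ltac:(lra)) as [delta [Hd0 Hd]].
    exists (mkposreal _ Hd0); intros h Hh0 Hh; simpl in Hh.
    specialize (Hd (x + h)); replace (x + h - x) with h in Hd by ring.
    specialize (Hd Hh).
    replace ((f (x + h) - f x) / h - l) with ((f (x + h) - f x - h * l) / h)
      by (field; auto).
    unfold Rdiv; rewrite Rabs_mult, Rabs_inv.
    assert (Hp := Rabs_pos_lt h Hh0).
    apply Rle_lt_trans with (eps / 2 * Rabs h * / Rabs h).
    + apply Rmult_le_compat_r; auto; left; now apply Rinv_0_lt_compat.
    + rewrite Rmult_assoc, Rinv_r; lra.
Qed.

Definition partials_on (U : R -> R -> Prop) (f : R -> R -> R) : Prop :=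
  forall t x, U t x ->
    ex_derive (fun s => f s x) t /\ ex_derive (fun y => f t y) x.

Definition bounded_on (U : R -> R -> Prop) (K : R) (f : R -> R -> R) : Prop :=
  forall t x, U t x -> Rabs (f t x) <= K.

Definition total_solution (U : R -> R -> Prop)
    (a b c k l m al be ga u p : R -> R -> R) : Prop :=
  forall t x, U t x ->
    is_derive (fun y => u t y) x (p t x) /\
    is_derive (fun y => p t y) x (a t x * u t x + b t x * p t x + c t x) /\
    is_derive (fun s => u s x) t (k t x * u t x + l t x * p t x + m t x) /\
    is_derive (fun s => p s x) t (al t x * u t x + be t x * p t x + ga t x).

Lemma Rabs_affine_le (a b c u p K : R) :
  Rabs a <= K -> Rabs b <= K ->
  Rabs (a * u + b * p + c) <= K * (Rabs u + Rabs p) + Rabs c.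
Proof.
  intros Ha Hb.
  eapply Rle_trans; [apply Rabs_triang|]; apply Rplus_le_compat_r.
  eapply Rle_trans; [apply Rabs_triang|].
  rewrite !Rabs_mult, Rmult_plus_distr_l.
  apply Rplus_le_compat; apply Rmult_le_compat_r; auto; apply Rabs_pos.
Qed.

(** An affine field is globally Lipschitz in the unknowns, so the condition on [r] involves only the
    coefficients and not [u0], [p0]. *)
Lemma affine_ode (a1 b1 c1 a2 b2 c2 : R -> R) (x0 r K u0 p0 : R) :
  0 < r -> 4 * r * K <= 1 ->
  (forall x, Rabs (x - x0) < r ->
     (ex_derive a1 x /\ ex_derive b1 x /\ ex_derive c1 x /\
      ex_derive a2 x /\ ex_derive b2 x /\ ex_derive c2 x) /\
     (Rabs (a1 x) <= K /\ Rabs (b1 x) <= K /\ Rabs (c1 x) <= K /\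
      Rabs (a2 x) <= K /\ Rabs (b2 x) <= K /\ Rabs (c2 x) <= K)) ->
  exists u p : R -> R, u x0 = u0 /\ p x0 = p0 /\
    forall x, Rabs (x - x0) < r ->
      is_derive u x (a1 x * u x + b1 x * p x + c1 x) /\
      is_derive p x (a2 x * u x + b2 x * p x + c2 x).
Proof.
  intros Hr HrK H.
  assert (HK : 0 <= K).
  { destruct (H x0) as [_ [H1 _]].
    - now rewrite Rminus_diag, Rabs_R0.
    - eapply Rle_trans; [apply Rabs_pos | exact H1]. }
  apply (picard_lindelof (fun x u p => a1 x * u + b1 x * p + c1 x)
           (fun x u p => a2 x * u + b2 x * p + c2 x) x0 r K
           (K * (Rabs u0 + Rabs p0) + K)); auto.
  - intros x u p u' p' Hx; destruct (H x Hx) as [_ [H1 [H2 [_ [H4 [H5 _]]]]]]; split.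
    + replace (a1 x * u + b1 x * p + c1 x - (a1 x * u' + b1 x * p' + c1 x))
        with (a1 x * (u - u') + b1 x * (p - p') + 0) by ring.
      assert (G := Rabs_affine_le (a1 x) (b1 x) 0 (u - u') (p - p') K H1 H2).
      rewrite Rabs_R0 in G; lra.
    + replace (a2 x * u + b2 x * p + c2 x - (a2 x * u' + b2 x * p' + c2 x))
        with (a2 x * (u - u') + b2 x * (p - p') + 0) by ring.
      assert (G := Rabs_affine_le (a2 x) (b2 x) 0 (u - u') (p - p') K H4 H5).
      rewrite Rabs_R0 in G; lra.
  - intros x Hx; destruct (H x Hx) as [_ [H1 [H2 [H3 [H4 [H5 H6]]]]]]; split.
    + assert (G := Rabs_affine_le (a1 x) (b1 x) (c1 x) u0 p0 K H1 H2); lra.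
    + assert (G := Rabs_affine_le (a2 x) (b2 x) (c2 x) u0 p0 K H4 H5); lra.
  - intros u p x Hx Hu Hp.
    destruct (H x Hx) as [[D1 [D2 [D3 [D4 [D5 D6]]]]] _].
    assert (C : forall f : R -> R, ex_derive f x -> continuous f x)
      by (intros f; apply (ex_derive_continuous (V := R_NormedModule))).
    split; apply (continuous_plus (V := R_NormedModule)); auto;
      apply (continuous_plus (V := R_NormedModule));
      apply (continuous_mult (K := R_AbsRing)); auto.
Qed.


Lemma derive_linear_combination (a u b p c : R -> R) (x u' p' : R) :
  ex_derive a x -> ex_derive b x -> ex_derive c x ->
  is_derive u x u' -> is_derive p x p' ->
  is_derive (fun y => a y * u y + b y * p y + c y) x
    (Derive a x * u x + a x * u' + (Derive b x * p x + b x * p') + Derive c x).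
Proof.
  intros Ha Hb Hc Hu Hp.
  apply (is_derive_plus (V := R_NormedModule)); [|now apply Derive_correct].
  apply (is_derive_plus (V := R_NormedModule));
    apply (is_derive_mult (K := R_AbsRing)); auto using Derive_correct;
    intros; apply Rmult_comm.
Qed.

(** The mean value inequality applied twice, first to [f] minus its tangent line, then to
    [Derive f]; the constant 1/2 is given up for simplicity. *)
Lemma taylor1_bound (f : R -> R) (s t K : R) :
  (forall y, Rmin t s <= y <= Rmax t s ->
     ex_derive f y /\ ex_derive (Derive f) y /\ Rabs (Derive (Derive f) y) <= K) ->
  Rabs (f s - f t - (s - t) * Derive f t) <= K * Rabs (s - t) * Rabs (s - t).
Proof.
  intros H.
  set (g := fun y => f y - (y - t) * Derive f t).
  replace (f s - f t - (s - t) * Derive f t) with (g s - g t) by (unfold g; ring).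
  apply is_derive_bounded_variation with (fun y => Derive f y - Derive f t).
  - intros y Hy; unfold g; auto_derive; [now apply H|]; change (fun x : R => f x) with f; ring.
  - intros y Hy.
    assert (Hsub : forall z, Rmin t y <= z <= Rmax t y -> Rmin t s <= z <= Rmax t s).
    { intros z; revert Hy; unfold Rmin, Rmax; repeat destruct Rle_dec; lra. }
    assert (HK : 0 <= K).
    { destruct (H t) as [_ [_ H1]].
      - unfold Rmin, Rmax; destruct Rle_dec; lra.
      - eapply Rle_trans; [apply Rabs_pos | exact H1]. }
    apply Rle_trans with (K * Rabs (y - t)).
    + apply is_derive_bounded_variation with (Derive (Derive f)).
      * intros z Hz; apply Derive_correct, H; auto.
      * intros z Hz; apply H; auto.
    + apply Rmult_le_compat_l; auto.
      revert Hy; unfold Rmin, Rmax, Rabs; repeat destruct Rle_dec;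
        repeat destruct Rcase_abs; lra.
Qed.

(** * Frobenius integration of a planar affine total differential system *)

Definition tame_on (U : R -> R -> Prop) (K : R) (f : R -> R -> R) : Prop :=
  forall t x, U t x ->
    ex_derive (fun s => f s x) t /\ ex_derive (fun y => f t y) x /\ Rabs (f t x) <= K.

Lemma tame_ex_t (U : R -> R -> Prop) (K : R) (f : R -> R -> R) (t x : R) :
  tame_on U K f -> U t x -> ex_derive (fun s => f s x) t.
Proof. intros H Hx; exact (proj1 (H t x Hx)). Qed.

Lemma tame_ex_x (U : R -> R -> Prop) (K : R) (f : R -> R -> R) (t x : R) :
  tame_on U K f -> U t x -> ex_derive (fun y => f t y) x.
Proof. intros H Hx; exact (proj1 (proj2 (H t x Hx))). Qed.

Lemma tame_le (U : R -> R -> Prop) (K : R) (f : R -> R -> R) (t x : R) :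
  tame_on U K f -> U t x -> Rabs (f t x) <= K.
Proof. intros H Hx; exact (proj2 (proj2 (H t x Hx))). Qed.

(** Meant for the coefficients of the [x]-equation: its solutions at neighbouring values of [t] are
    compared to first order with a quadratic error, which takes a bound on the second
    [t]-derivative. *)
Definition t_tame_on (U : R -> R -> Prop) (K : R) (f : R -> R -> R) : Prop :=
  tame_on U K f /\ tame_on U K (dt f) /\ bounded_on U K (dt (dt f)).

(** Equality of mixed derivatives, read off as coefficients of [u], [p] and 1. The first three lines
    come from differentiating [k u + l p + m] in [x]; the last three equate the [x]-derivative of
    [al u + be p + ga] with the [t]-derivative of [a u + b p + c]. *)
Definition compatible_on (U : R -> R -> Prop) (a b c k l m al be ga : R -> R -> R) : Prop :=
  forall t x, U t x ->
    dx k t x + l t x * a t x = al t x /\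
    k t x + dx l t x + l t x * b t x = be t x /\
    l t x * c t x + dx m t x = ga t x /\
    dx al t x + be t x * a t x = a t x * k t x + b t x * al t x + dt a t x /\
    al t x + dx be t x + be t x * b t x = a t x * l t x + b t x * be t x + dt b t x /\
    be t x * c t x + dx ga t x = a t x * m t x + b t x * ga t x + dt c t x.

Lemma t_tame_increment (t0 x0 r K : R) (f : R -> R -> R) (t s x : R) :
  t_tame_on (box t0 x0 r) K f -> Rabs (t - t0) < r -> Rabs (s - t0) < r ->
  Rabs (x - x0) < r ->
  Rabs (f s x - f t x) <= K * Rabs (s - t) /\
  Rabs (f s x - f t x - (s - t) * dt f t x) <= K * Rabs (s - t) * Rabs (s - t).
Proof.
  intros [H1 [H2 H3]] Ht Hs Hx.
  assert (Hsub : forall z, Rmin t s <= z <= Rmax t s -> box t0 x0 r z x).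
  { intros z Hz; split; auto.
    revert Ht Hs Hz; unfold Rmin, Rmax, Rabs; repeat destruct Rle_dec;
      repeat destruct Rcase_abs; lra. }
  split.
  - apply (is_derive_bounded_variation (fun z => f z x) (fun z => dt f z x)).
    + intros z Hz; exact (Derive_correct _ _ (tame_ex_t _ _ _ _ _ H1 (Hsub z Hz))).
    + intros z Hz; exact (tame_le _ _ _ _ _ H2 (Hsub z Hz)).
  - apply (taylor1_bound (fun z => f z x)); intros z Hz; split; [|split].
    + exact (tame_ex_t _ _ _ _ _ H1 (Hsub z Hz)).
    + exact (tame_ex_t _ _ _ _ _ H2 (Hsub z Hz)).
    + exact (H3 z x (Hsub z Hz)).
Qed.

(** By construction the [x]-equations hold everywhere and the [t]-equations on the axis [x = x0].
    Compatibility carries the latter off the axis through an error estimate that is itself an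
    instance of [planar_growth] in [x]. *)
Lemma frobenius (t0 x0 r K u0 p0 : R) (a b c k l m al be ga : R -> R -> R) :
  0 < r -> 1 <= K -> 4 * r * K <= 1 ->
  t_tame_on (box t0 x0 r) K a -> t_tame_on (box t0 x0 r) K b ->
  t_tame_on (box t0 x0 r) K c ->
  tame_on (box t0 x0 r) K k -> tame_on (box t0 x0 r) K l ->
  tame_on (box t0 x0 r) K m -> tame_on (box t0 x0 r) K al ->
  tame_on (box t0 x0 r) K be -> tame_on (box t0 x0 r) K ga ->
  compatible_on (box t0 x0 r) a b c k l m al be ga ->
  exists (u p : R -> R -> R) (M : R), u t0 x0 = u0 /\ p t0 x0 = p0 /\
    total_solution (box t0 x0 r) a b c k l m al be ga u p /\
    bounded_on (box t0 x0 r) M u /\ bounded_on (box t0 x0 r) M p.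
Proof.
  intros Hr HK HrK Ha' Hb' Hc' Hk Hl Hm Hal Hbe Hga Hcomp.
  assert (Hx0 : Rabs (x0 - x0) < r) by (rewrite Rminus_diag, Rabs_R0; auto).
  destruct (conj Ha' (conj Hb' Hc'))
    as [[Ha [Hat _]] [[Hb [Hbt _]] [Hc [Hct _]]]].
  assert (Hrad : forall y y0, Rabs (y - y0) < r -> 4 * Rabs (y - y0) * K <= 1).
  { intros y y0 Hy; assert (0 <= Rabs (y - y0)) by apply Rabs_pos; nra. }
  destruct (affine_ode (fun t => k t x0) (fun t => l t x0) (fun t => m t x0)
              (fun t => al t x0) (fun t => be t x0) (fun t => ga t x0)
              t0 r K u0 p0 Hr HrK) as [y1 [y2 [Hy1 [Hy2 Hy]]]].
  { intros t Ht; assert (Hb0 : box t0 x0 r t x0) by (split; auto).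
    repeat split; eauto using tame_ex_t, tame_le. }
  (* The range condition on [t] sits inside the existential so that choice yields a function of
     every real [t]; outside the interval the zero pair is a default value. *)
  assert (HV : forall t, exists w : (R -> R) * (R -> R), Rabs (t - t0) < r ->
            fst w x0 = y1 t /\ snd w x0 = y2 t /\
            forall x, Rabs (x - x0) < r ->
              is_derive (fst w) x (snd w x) /\
              is_derive (snd w) x (a t x * fst w x + b t x * snd w x + c t x)).
  { intros t; destruct (Rlt_dec (Rabs (t - t0)) r) as [Ht | Ht].
    2:{ exists (fun _ => 0, fun _ => 0); intros; contradiction. }
    destruct (affine_ode (fun _ => 0) (fun _ => 1) (fun _ => 0) (a t) (b t) (c t)
                x0 r K (y1 t) (y2 t) Hr HrK) as [u [p [H1 [H2 H]]]].
    { intros x Hx; assert (Hbx : box t0 x0 r t x) by (split; auto).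
      rewrite Rabs_R0, Rabs_R1.
      repeat split;
        match goal with
        | |- ex_derive (fun _ => ?v) _ => apply ex_derive_const
        | |- ex_derive _ _ => eapply tame_ex_x; eauto
        | |- Rabs _ <= _ => eapply tame_le; eauto
        | |- _ <= _ => lra
        end. }
    exists (u, p); intros _; simpl; split; [auto|]; split; [auto|].
    intros x Hx; destruct (H x Hx) as [D1 D2]; split; [|exact D2].
    replace (p x) with (0 * u x + 1 * p x + 0) by ring; exact D1. }
  set (u := fun t => fst (proj1_sig (constructive_indefinite_description _ (HV t)))).
  set (p := fun t => snd (proj1_sig (constructive_indefinite_description _ (HV t)))).
  assert (Hinit : forall t, Rabs (t - t0) < r -> u t x0 = y1 t /\ p t x0 = y2 t).
  { intros t Ht.
    destruct (proj2_sig (constructive_indefinite_description _ (HV t)) Ht) as [H1 [H2 _]].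
    split; auto. }
  assert (Hup : forall t x, box t0 x0 r t x ->
            is_derive (u t) x (p t x) /\
            is_derive (p t) x (a t x * u t x + b t x * p t x + c t x)).
  { intros t x [Ht Hx].
    destruct (proj2_sig (constructive_indefinite_description _ (HV t)) Ht) as [_ [_ H]].
    apply H; auto. }
  clearbody u p; clear HV.
  (* [N] bounds the solution on the axis and [M], below, on the whole box. Both come from
     [planar_growth] with [eps = K], the bound on the inhomogeneities. *)
  set (N := 4 * (Rabs u0 + Rabs p0) + 4 * r * K).
  assert (HyN : forall t, Rabs (t - t0) < r -> Rabs (y1 t) + Rabs (y2 t) <= N).
  { intros t Ht.
    apply Rle_trans with (4 * (Rabs u0 + Rabs p0) + 4 * Rabs (t - t0) * K).
    2:{ unfold N; nra. }
    eapply planar_growth; [ | | apply Hrad; auto | | | ]; try lra.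
    - intros s Hs; assert (Hs' := between_center _ _ _ _ Ht Hs).
      destruct (Hy s Hs') as [D1 D2].
      assert (Hbs : box t0 x0 r s x0) by (split; auto).
      split; [exact D1|]; split; [exact D2|]; split.
      + eapply Rle_trans; [apply Rabs_affine_le; eauto using tame_le|].
        apply Rplus_le_compat_l; eauto using tame_le.
      + eapply Rle_trans; [apply Rabs_affine_le; eauto using tame_le|].
        apply Rplus_le_compat_l; eauto using tame_le.
    - rewrite Hy1; assert (H := Rabs_pos p0); lra.
    - rewrite Hy2; assert (H := Rabs_pos u0); lra. }
  set (M := 4 * N + 4 * r * K).
  assert (HM : forall t x, box t0 x0 r t x -> Rabs (u t x) + Rabs (p t x) <= M).
  { intros t x [Ht Hx].
    apply Rle_trans with (4 * N + 4 * Rabs (x - x0) * K).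
    2:{ unfold M; nra. }
    destruct (Hinit t Ht) as [I1 I2]; specialize (HyN t Ht).
    assert (P1 := Rabs_pos (y1 t)); assert (P2 := Rabs_pos (y2 t)).
    eapply planar_growth; [ | | apply Hrad; auto | | | ]; try lra.
    - intros y Hy'; assert (Hby : box t0 x0 r t y)
        by (split; auto; eapply between_center; eauto).
      destruct (Hup t y Hby) as [D1 D2].
      assert (Q1 := Rabs_pos (u t y)); assert (Q2 := Rabs_pos (p t y)).
      split; [exact D1|]; split; [exact D2|]; split.
      + nra.
      + eapply Rle_trans; [apply Rabs_affine_le; eauto using tame_le|].
        apply Rplus_le_compat_l; eauto using tame_le.
    - rewrite I1; lra.
    - rewrite I2; lra. }
  assert (HM0 : 0 <= M).
  { eapply Rle_trans; [|apply (HM t0 x0); split; auto].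
    - apply Rplus_le_le_0_compat; apply Rabs_pos.
    - now rewrite Rminus_diag, Rabs_R0. }
  (* [L] bounds the right-hand sides along the axis, hence is a Lipschitz constant of [y1] and
     [y2]. *)
  set (L := K * N + K).
  assert (HyL : forall t s, Rabs (t - t0) < r -> Rabs (s - t0) < r ->
            Rabs (y1 s - y1 t) <= L * Rabs (s - t) /\
            Rabs (y2 s - y2 t) <= L * Rabs (s - t)).
  { intros t s Ht Hs.
    assert (Hsub : forall z, Rmin t s <= z <= Rmax t s -> Rabs (z - t0) < r).
    { intros z Hz; revert Ht Hs Hz; unfold Rmin, Rmax, Rabs; repeat destruct Rle_dec;
        repeat destruct Rcase_abs; lra. }
    assert (Hbz : forall z, Rmin t s <= z <= Rmax t s -> box t0 x0 r z x0)
      by (intros z Hz; split; auto).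
    assert (Hbd : forall f g h : R -> R -> R,
              tame_on (box t0 x0 r) K f -> tame_on (box t0 x0 r) K g ->
              tame_on (box t0 x0 r) K h -> forall z, Rmin t s <= z <= Rmax t s ->
              Rabs (f z x0 * y1 z + g z x0 * y2 z + h z x0) <= L).
    { intros f g h Hf Hg Hh z Hz; unfold L.
      eapply Rle_trans;
        [apply Rabs_affine_le with (K := K); eapply tame_le; eauto|].
      apply Rplus_le_compat; [|eapply tame_le; eauto].
      apply Rmult_le_compat_l; auto; lra. }
    split.
    - apply is_derive_bounded_variation
        with (fun z => k z x0 * y1 z + l z x0 * y2 z + m z x0); auto.
      intros z Hz; exact (proj1 (Hy z (Hsub z Hz))).
    - apply is_derive_bounded_variation
        with (fun z => al z x0 * y1 z + be z x0 * y2 z + ga z x0); auto.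
      intros z Hz; exact (proj2 (Hy z (Hsub z Hz))). }
  (* Lipschitz dependence on [t] off the axis. The difference of the solutions at [s] and [t] obeys
     the linear equation at [t], forced by the coefficient increments acting on the solution at [s];
     the forcing is at most [(K * M + K) * |s - t|]. *)
  set (L2 := 4 * L + 4 * r * (K * M + K)).
  assert (HL2 : forall t s x, Rabs (t - t0) < r -> Rabs (s - t0) < r ->
            Rabs (x - x0) < r ->
            Rabs (u s x - u t x) + Rabs (p s x - p t x) <= L2 * Rabs (s - t)).
  { intros t s x Ht Hs Hx.
    assert (Hst := Rabs_pos (s - t)).
    apply Rle_trans with (4 * (L * Rabs (s - t))
                          + 4 * Rabs (x - x0) * ((K * M + K) * Rabs (s - t))).
    2:{ unfold L2; assert (0 <= K * M) by nra.
        assert (0 <= (K * M + K) * Rabs (s - t)) by (apply Rmult_le_pos; lra).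
        nra. }
    destruct (Hinit t Ht) as [I1 I2]; destruct (Hinit s Hs) as [J1 J2].
    destruct (HyL t s Ht Hs) as [G1 G2].
    apply (planar_growth (fun y => u s y - u t y) (fun y => p s y - p t y)
             (fun y => p s y - p t y)
             (fun y => a s y * u s y + b s y * p s y + c s y
                       - (a t y * u t y + b t y * p t y + c t y)) x0 x K).
    - lra.
    - apply Rmult_le_pos; auto; nra.
    - now apply Hrad.
    - intros y Hy'; assert (Hy0 := between_center _ _ _ _ Hx Hy').
      assert (Ht' : box t0 x0 r t y) by (split; auto).
      assert (Hs' : box t0 x0 r s y) by (split; auto).
      destruct (Hup t y Ht') as [D1 D2]; destruct (Hup s y Hs') as [E1 E2].
      split; [now apply (is_derive_minus (V := R_NormedModule))|].
      split; [now apply (is_derive_minus (V := R_NormedModule))|].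
      assert (Q1 := Rabs_pos (u s y - u t y)); assert (Q2 := Rabs_pos (p s y - p t y)).
      assert (Q3 : 0 <= (K * M + K) * Rabs (s - t)) by (apply Rmult_le_pos; nra).
      split; [nra|].
      replace (a s y * u s y + b s y * p s y + c s y
               - (a t y * u t y + b t y * p t y + c t y))
        with (a t y * (u s y - u t y) + b t y * (p s y - p t y)
              + ((a s y - a t y) * u s y + (b s y - b t y) * p s y + (c s y - c t y)))
        by ring.
      eapply Rle_trans; [apply Rabs_affine_le with (K := K); eauto using tame_le|].
      apply Rplus_le_compat_l.
      eapply Rle_trans.
      { apply Rabs_affine_le with (K := K * Rabs (s - t));
          eapply t_tame_increment; eauto. }
      assert (HMs := HM s y Hs').
      destruct (t_tame_increment _ _ _ _ _ _ _ _ Hc' Ht Hs Hy0) as [G3 _].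
      assert (K * Rabs (s - t) * (Rabs (u s y) + Rabs (p s y)) <= K * Rabs (s - t) * M)
        by (apply Rmult_le_compat_l; auto; nra).
      lra.
    - rewrite I1, J1; auto.
    - rewrite I2, J2; auto. }
  (* The candidates for the [t]-derivatives of [u] and [p]. *)
  set (z := fun t x => k t x * u t x + l t x * p t x + m t x).
  set (w := fun t x => al t x * u t x + be t x * p t x + ga t x).
  assert (Hzw : forall t x, box t0 x0 r t x ->
            is_derive (z t) x (w t x) /\
            is_derive (w t) x (a t x * z t x + b t x * w t x
                               + (dt a t x * u t x + dt b t x * p t x + dt c t x))).
  { intros t x Hx; destruct (Hup t x Hx) as [D1 D2].
    destruct (Hcomp t x Hx) as [C1 [C2 [C3 [C4 [C5 C6]]]]]; split.
    - replace (w t x) with (dx k t x * u t x + k t x * p t x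
          + (dx l t x * p t x + l t x * (a t x * u t x + b t x * p t x + c t x))
          + dx m t x)
        by (unfold w; rewrite <- C1, <- C2, <- C3; ring).
      apply derive_linear_combination; eauto using tame_ex_x.
    - replace (a t x * z t x + b t x * w t x
               + (dt a t x * u t x + dt b t x * p t x + dt c t x))
        with (dx al t x * u t x + al t x * p t x
          + (dx be t x * p t x + be t x * (a t x * u t x + b t x * p t x + c t x))
          + dx ga t x).
      (* The difference of the two sides is the sum of the last three compatibility defects
         multiplied by [u], [p] and 1. *)
      2:{ apply Rminus_diag_uniq.
          transitivity
            ((dx al t x + be t x * a t x - (a t x * k t x + b t x * al t x + dt a t x)) * u t x
             + (al t x + dx be t x + be t x * b t x
                - (a t x * l t x + b t x * be t x + dt b t x)) * p t x
             + (be t x * c t x + dx ga t x - (a t x * m t x + b t x * ga t x + dt c t x))).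
          - unfold z, w; ring.
          - rewrite C4, C5, C6; ring. }
      apply derive_linear_combination; eauto using tame_ex_x. }
  (* The quadratic forcing in the equation for the Taylor error: [K * M] from the remainders of [a]
     and [b], [K] from that of [c], and [K * L2] from [dt a] and [dt b] acting on the increments of
     [u] and [p]. *)
  set (Q := K * M + K + K * L2).
  assert (HL2pos : 0 <= N -> 0 <= L2).
  { intros HN; unfold L2, L; assert (0 <= K * N) by nra; assert (0 <= K * M) by nra; nra. }
  assert (HN0 : 0 <= N).
  { unfold N; assert (H1 := Rabs_pos u0); assert (H2 := Rabs_pos p0); nra. }
  specialize (HL2pos HN0).
  assert (HQ0 : 0 <= Q) by (unfold Q; nra).
  assert (Herr : forall t s x d, Rabs (t - t0) < r -> Rabs (s - t0) < r ->
            Rabs (x - x0) < r ->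
            Rabs (y1 s - y1 t - (s - t) * z t x0) <= d ->
            Rabs (y2 s - y2 t - (s - t) * w t x0) <= d ->
            Rabs (u s x - u t x - (s - t) * z t x)
            + Rabs (p s x - p t x - (s - t) * w t x)
            <= 4 * d + 4 * Rabs (x - x0) * (Q * Rabs (s - t) * Rabs (s - t))).
  { intros t s x d Ht Hs Hx Hd1 Hd2.
    assert (Hst := Rabs_pos (s - t)).
    destruct (Hinit t Ht) as [I1 I2]; destruct (Hinit s Hs) as [J1 J2].
    apply (planar_growth (fun y => u s y - u t y - (s - t) * z t y)
             (fun y => p s y - p t y - (s - t) * w t y)
             (fun y => p s y - p t y - (s - t) * w t y)
             (fun y => a s y * u s y + b s y * p s y + c s y
                       - (a t y * u t y + b t y * p t y + c t y)
                       - (s - t) * (a t y * z t y + b t y * w t y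
                          + (dt a t y * u t y + dt b t y * p t y + dt c t y))) x0 x K).
    - lra.
    - apply Rmult_le_pos; auto; nra.
    - now apply Hrad.
    - intros y Hy'; assert (Hy0 := between_center _ _ _ _ Hx Hy').
      assert (Ht' : box t0 x0 r t y) by (split; auto).
      assert (Hs' : box t0 x0 r s y) by (split; auto).
      destruct (Hup t y Ht') as [D1 D2]; destruct (Hup s y Hs') as [E1 E2].
      destruct (Hzw t y Ht') as [F1 F2].
      split.
      { apply (is_derive_minus (V := R_NormedModule));
          [now apply (is_derive_minus (V := R_NormedModule))|].
        now apply (is_derive_scal (z t) y (s - t)). }
      split.
      { apply (is_derive_minus (V := R_NormedModule));
          [now apply (is_derive_minus (V := R_NormedModule))|].
        now apply (is_derive_scal (w t) y (s - t)). }
      assert (Q1 := Rabs_pos (u s y - u t y - (s - t) * z t y)).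
      assert (Q2 := Rabs_pos (p s y - p t y - (s - t) * w t y)).
      assert (Q3 : 0 <= Q * Rabs (s - t) * Rabs (s - t))
        by (apply Rmult_le_pos; nra).
      split; [nra|].
      replace (a s y * u s y + b s y * p s y + c s y
               - (a t y * u t y + b t y * p t y + c t y)
               - (s - t) * (a t y * z t y + b t y * w t y
                  + (dt a t y * u t y + dt b t y * p t y + dt c t y)))
        with (a t y * (u s y - u t y - (s - t) * z t y)
              + b t y * (p s y - p t y - (s - t) * w t y)
              + ((a s y - a t y - (s - t) * dt a t y) * u s y
                 + (b s y - b t y - (s - t) * dt b t y) * p s y
                 + ((c s y - c t y - (s - t) * dt c t y)
                    + (dt a t y * (u s y - u t y) + dt b t y * (p s y - p t y) + 0)
                      * (s - t))))
        by ring.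
      eapply Rle_trans; [apply Rabs_affine_le with (K := K); eauto using tame_le|].
      apply Rplus_le_compat_l.
      eapply Rle_trans.
      { apply Rabs_affine_le with (K := K * Rabs (s - t) * Rabs (s - t));
          eapply t_tame_increment; eauto. }
      assert (HMs := HM s y Hs').
      destruct (t_tame_increment _ _ _ _ _ _ _ _ Hc' Ht Hs Hy0) as [_ G3].
      assert (G4 : Rabs (dt a t y * (u s y - u t y) + dt b t y * (p s y - p t y) + 0)
                   <= K * (L2 * Rabs (s - t))).
      { eapply Rle_trans; [apply Rabs_affine_le with (K := K); eauto using tame_le|].
        rewrite Rabs_R0, Rplus_0_r; apply Rmult_le_compat_l; [lra | auto]. }
      assert (G5 := Rabs_triang (c s y - c t y - (s - t) * dt c t y)
        ((dt a t y * (u s y - u t y) + dt b t y * (p s y - p t y) + 0) * (s - t))).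
      rewrite (Rabs_mult _ (s - t)) in G5.
      assert (Rabs (dt a t y * (u s y - u t y) + dt b t y * (p s y - p t y) + 0)
              * Rabs (s - t) <= K * (L2 * Rabs (s - t)) * Rabs (s - t))
        by (apply Rmult_le_compat_r; auto).
      assert (0 <= K * Rabs (s - t) * Rabs (s - t)) by (apply Rmult_le_pos; nra).
      assert (K * Rabs (s - t) * Rabs (s - t) * (Rabs (u s y) + Rabs (p s y))
              <= K * Rabs (s - t) * Rabs (s - t) * M)
        by (apply Rmult_le_compat_l; auto).
      unfold Q; nra.
    - rewrite I1, J1; auto.
    - rewrite I2, J2; auto. }
  assert (Hdt : forall t x, box t0 x0 r t x -> forall eps, 0 < eps ->
            exists delta, 0 < delta /\ forall s, Rabs (s - t) < delta ->
              Rabs (u s x - u t x - (s - t) * z t x)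
              + Rabs (p s x - p t x - (s - t) * w t x) <= eps * Rabs (s - t)).
  { intros t x [Ht Hx] eps He.
    destruct (Hinit t Ht) as [I1 I2].
    destruct (Hy t Ht) as [D1 D2].
    rewrite <- I1, <- I2 in D1, D2.
    (* [Herr] multiplies the axis error by 4, so [eps / 8] leaves [eps / 2] for the quadratic term,
       whose factor [4 * |x - x0|] is at most 1. *)
    destruct (proj1 (is_derive_error y1 t (z t x0)) D1 (eps / 8) ltac:(lra)) as [d1 [Hd1 G1]].
    destruct (proj1 (is_derive_error y2 t (w t x0)) D2 (eps / 8) ltac:(lra)) as [d2 [Hd2 G2]].
    assert (Hd3 : 0 < r - Rabs (t - t0)) by lra.
    assert (Hd4 : 0 < eps / (2 * (Q + 1))) by (apply Rdiv_lt_0_compat; lra).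
    exists (Rmin (Rmin d1 d2) (Rmin (r - Rabs (t - t0)) (eps / (2 * (Q + 1))))).
    split; [repeat apply Rmin_pos; auto|].
    intros s Hs.
    assert (Hs1 : Rabs (s - t) < d1)
      by (eapply Rlt_le_trans; [exact Hs | eapply Rle_trans; [apply Rmin_l | apply Rmin_l]]).
    assert (Hs2 : Rabs (s - t) < d2)
      by (eapply Rlt_le_trans; [exact Hs | eapply Rle_trans; [apply Rmin_l | apply Rmin_r]]).
    assert (Hs3 : Rabs (s - t) < r - Rabs (t - t0))
      by (eapply Rlt_le_trans; [exact Hs | eapply Rle_trans; [apply Rmin_r | apply Rmin_l]]).
    assert (Hs4 : Rabs (s - t) < eps / (2 * (Q + 1)))
      by (eapply Rlt_le_trans; [exact Hs | eapply Rle_trans; [apply Rmin_r | apply Rmin_r]]).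
    assert (Hs5 : Rabs (s - t0) < r).
    { replace (s - t0) with ((s - t) + (t - t0)) by ring.
      eapply Rle_lt_trans; [apply Rabs_triang | lra]. }
    eapply Rle_trans.
    { apply (Herr t s x (eps / 8 * Rabs (s - t))); auto. }
    assert (Hst := Rabs_pos (s - t)).
    assert (HQs : Q * Rabs (s - t) <= eps / 2).
    { apply Rle_trans with ((Q + 1) * (eps / (2 * (Q + 1)))); [nra|].
      right; field; lra. }
    assert (4 * Rabs (x - x0) <= 1) by (assert (Hxp := Rabs_pos (x - x0)); nra).
    assert (Q * Rabs (s - t) * Rabs (s - t) <= eps / 2 * Rabs (s - t))
      by (apply Rmult_le_compat_r; auto).
    assert (0 <= Q * Rabs (s - t) * Rabs (s - t)) by (apply Rmult_le_pos; nra).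
    nra. }
  exists u, p, M; split; [|split; [|split; [|split]]].
  - rewrite (proj1 (Hinit t0 ltac:(now rewrite Rminus_diag, Rabs_R0))); auto.
  - rewrite (proj2 (Hinit t0 ltac:(now rewrite Rminus_diag, Rabs_R0))); auto.
  - intros t x Hx; destruct (Hup t x Hx) as [D1 D2].
    split; [exact D1|]; split; [exact D2|]; split.
    + apply (is_derive_error (fun s => u s x) t (z t x)); intros eps He.
      destruct (Hdt t x Hx eps He) as [d [Hd G]]; exists d; split; auto.
      intros s Hs; specialize (G s Hs).
      assert (G2 := Rabs_pos (p s x - p t x - (s - t) * w t x)); lra.
    + apply (is_derive_error (fun s => p s x) t (w t x)); intros eps He.
      destruct (Hdt t x Hx eps He) as [d [Hd G]]; exists d; split; auto.
      intros s Hs; specialize (G s Hs).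
      assert (G2 := Rabs_pos (u s x - u t x - (s - t) * z t x)); lra.
  - intros t x Hx; assert (G := HM t x Hx); assert (G2 := Rabs_pos (p t x)); lra.
  - intros t x Hx; assert (G := HM t x Hx); assert (G2 := Rabs_pos (u t x)); lra.
Qed.

(** * Calculus of smooth functions on open sets *)

Definition Cn_on (n : nat) (U : R -> R -> Prop) (f : R -> R -> R) : Prop :=
  forall t x, U t x -> ex_diff_n f n t x.


(** Peels off one order on the whole set at once. The closure properties below then go by induction
    on the order, with [dt f] and [dx f] replaced by formulas valid on the set. *)
Lemma Cn_on_S (n : nat) (U : R -> R -> Prop) (f : R -> R -> R) :
  Cn_on (S n) U f <->
  Cn_on 0 U f /\ partials_on U f /\ Cn_on n U (dt f) /\ Cn_on n U (dx f).
Proof.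
  split.
  - intros H; split; [|split; [|split]]; intros t x Hx;
      destruct (H t x Hx) as [Hc [H1 [H2 [H3 H4]]]].
    + split; auto.
    + split; auto.
    + exact H3.
    + exact H4.
  - intros H t x Hx; destruct H as [Hc [Hp [H2 H3]]]; destruct (Hp t x Hx) as [H4 H5].
    split; [exact (proj1 (Hc t x Hx)) | split; [auto | split; [auto | split]]].
    + now apply H2.
    + now apply H3.
Qed.

Lemma Cn_on_le (m n : nat) (U : R -> R -> Prop) (f : R -> R -> R) :
  (m <= n)%nat -> Cn_on n U f -> Cn_on m U f.
Proof. intros Hmn H t x Hx; apply (ex_diff_n_m n m Hmn), H, Hx. Qed.

Lemma Cn_on_ext (n : nat) (U : R -> R -> Prop) (f g : R -> R -> R) :
  open2 U -> (forall t x, U t x -> f t x = g t x) -> Cn_on n U f -> Cn_on n U g.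
Proof.
  intros HU Hfg H t x Hx; apply ex_diff_n_ext_loc with f; [|now apply H].
  destruct (HU t x Hx) as [d Hd]; exists d; intros; apply Hfg; auto.
Qed.

Lemma open2_t (U : R -> R -> Prop) (t x : R) :
  open2 U -> U t x -> locally t (fun s => U s x).
Proof. intros HU Hx; apply locally_2d_1d_const_y with (P := U); now apply HU. Qed.

Lemma open2_x (U : R -> R -> Prop) (t x : R) :
  open2 U -> U t x -> locally x (fun y => U t y).
Proof. intros HU Hx; apply locally_2d_1d_const_x with (P := U); now apply HU. Qed.

Lemma dt_ext_on (U : R -> R -> Prop) (f g : R -> R -> R) :
  open2 U -> (forall t x, U t x -> f t x = g t x) ->
  forall t x, U t x -> dt f t x = dt g t x.
Proof.
  intros HU H t x Hx; apply Derive_ext_loc.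
  generalize (open2_t U t x HU Hx); apply filter_imp; auto.
Qed.

Lemma dx_ext_on (U : R -> R -> Prop) (f g : R -> R -> R) :
  open2 U -> (forall t x, U t x -> f t x = g t x) ->
  forall t x, U t x -> dx f t x = dx g t x.
Proof.
  intros HU H t x Hx; apply Derive_ext_loc.
  generalize (open2_x U t x HU Hx); apply filter_imp; auto.
Qed.

Lemma box_open (t0 x0 r : R) : open2 (box t0 x0 r).
Proof.
  intros t x [Ht Hx].
  destruct (locally_center t0 t r Ht) as [d1 H1].
  destruct (locally_center x0 x r Hx) as [d2 H2].
  assert (Hd : 0 < Rmin d1 d2) by (apply Rmin_pos; apply cond_pos).
  exists (mkposreal _ Hd); simpl; intros s y Hs Hy; split.
  - apply H1; eapply Rlt_le_trans; [exact Hs | apply Rmin_l].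
  - apply H2; eapply Rlt_le_trans; [exact Hy | apply Rmin_r].
Qed.

Lemma Cn_on_const (n : nat) (U : R -> R -> Prop) (c : R) :
  Cn_on n U (fun _ _ => c).
Proof.
  revert c; induction n as [|n IH]; intros c.
  - intros t x _; split; auto using continuity_2d_pt_const.
  - apply Cn_on_S; repeat split; try apply ex_derive_const.
    + apply continuity_2d_pt_const.
    + intros t x Hx; apply ex_diff_n_ext_loc with (fun _ _ => 0); [|now apply IH].
      apply locally_2d_forall; intros s y; symmetry; exact (Derive_const c s).
    + intros t x Hx; apply ex_diff_n_ext_loc with (fun _ _ => 0); [|now apply IH].
      apply locally_2d_forall; intros s y; symmetry; exact (Derive_const c y).
Qed.

Lemma Cn_on_plus (n : nat) (U : R -> R -> Prop) (f g : R -> R -> R) :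
  open2 U -> Cn_on n U f -> Cn_on n U g -> Cn_on n U (fun t x => f t x + g t x).
Proof.
  intros HU; revert f g; induction n as [|n IH]; intros f g Hf Hg.
  - intros t x Hx; split; auto.
    exact (continuity_2d_pt_plus _ _ _ _ (proj1 (Hf t x Hx)) (proj1 (Hg t x Hx))).
  - apply Cn_on_S in Hf; apply Cn_on_S in Hg; apply Cn_on_S.
    destruct Hf as [F0 [F1 [F2 F3]]]; destruct Hg as [G0 [G1 [G2 G3]]].
    split; [|split; [|split]].
    + intros t x Hx; split; auto.
      exact (continuity_2d_pt_plus _ _ _ _ (proj1 (F0 t x Hx)) (proj1 (G0 t x Hx))).
    + intros t x Hx; destruct (F1 t x Hx); destruct (G1 t x Hx).
      split; now apply (ex_derive_plus (V := R_NormedModule)).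
    + apply Cn_on_ext with (fun t x => dt f t x + dt g t x); auto.
      intros t x Hx; symmetry; exact (Derive_plus (fun s => f s x) (fun s => g s x) t
          (proj1 (F1 t x Hx)) (proj1 (G1 t x Hx))).
    + apply Cn_on_ext with (fun t x => dx f t x + dx g t x); auto.
      intros t x Hx; symmetry; exact (Derive_plus (fun y => f t y) (fun y => g t y) x
          (proj2 (F1 t x Hx)) (proj2 (G1 t x Hx))).
Qed.

Lemma Cn_on_mult (n : nat) (U : R -> R -> Prop) (f g : R -> R -> R) :
  open2 U -> Cn_on n U f -> Cn_on n U g -> Cn_on n U (fun t x => f t x * g t x).
Proof.
  intros HU; revert f g; induction n as [|n IH]; intros f g Hf Hg.
  - intros t x Hx; split; auto.
    exact (continuity_2d_pt_mult _ _ _ _ (proj1 (Hf t x Hx)) (proj1 (Hg t x Hx))).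
  - assert (Hf' := Cn_on_le n (S n) _ _ ltac:(lia) Hf).
    assert (Hg' := Cn_on_le n (S n) _ _ ltac:(lia) Hg).
    apply Cn_on_S in Hf; apply Cn_on_S in Hg; apply Cn_on_S.
    destruct Hf as [F0 [F1 [F2 F3]]]; destruct Hg as [G0 [G1 [G2 G3]]].
    split; [|split; [|split]].
    + intros t x Hx; split; auto.
      exact (continuity_2d_pt_mult _ _ _ _ (proj1 (F0 t x Hx)) (proj1 (G0 t x Hx))).
    + intros t x Hx; destruct (F1 t x Hx); destruct (G1 t x Hx).
      split; now apply ex_derive_mult.
    + apply Cn_on_ext with (fun t x => dt f t x * g t x + f t x * dt g t x); auto.
      * intros t x Hx; symmetry; exact (Derive_mult (fun s => f s x) (fun s => g s x) t
          (proj1 (F1 t x Hx)) (proj1 (G1 t x Hx))).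
      * apply Cn_on_plus; auto.
    + apply Cn_on_ext with (fun t x => dx f t x * g t x + f t x * dx g t x); auto.
      * intros t x Hx; symmetry; exact (Derive_mult (fun y => f t y) (fun y => g t y) x
          (proj2 (F1 t x Hx)) (proj2 (G1 t x Hx))).
      * apply Cn_on_plus; auto.
Qed.

Lemma Cn_on_opp (n : nat) (U : R -> R -> Prop) (f : R -> R -> R) :
  open2 U -> Cn_on n U f -> Cn_on n U (fun t x => - f t x).
Proof.
  intros HU Hf; apply Cn_on_ext with (fun t x => -1 * f t x); auto.
  - intros; ring.
  - apply Cn_on_mult; auto using Cn_on_const.
Qed.

Lemma Cn_on_inv (n : nat) (U : R -> R -> Prop) (f : R -> R -> R) :
  open2 U -> (forall t x, U t x -> f t x <> 0) ->
  Cn_on n U f -> Cn_on n U (fun t x => / f t x).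
Proof.
  intros HU Hnz; revert f Hnz; induction n as [|n IH]; intros f Hnz Hf.
  - intros t x Hx; split; auto.
    exact (continuity_2d_pt_inv _ _ _ (proj1 (Hf t x Hx)) (Hnz t x Hx)).
  - assert (Hf' := Cn_on_le n (S n) _ _ ltac:(lia) Hf).
    apply Cn_on_S in Hf; apply Cn_on_S.
    destruct Hf as [F0 [F1 [F2 F3]]].
    split; [|split; [|split]].
    + intros t x Hx; split; auto.
      exact (continuity_2d_pt_inv _ _ _ (proj1 (F0 t x Hx)) (Hnz t x Hx)).
    + intros t x Hx; destruct (F1 t x Hx); specialize (Hnz t x Hx).
      split; now apply ex_derive_inv.
    (* Writing the inverse square as a product of two inverses leaves only [/ f] at order [n], where
       the induction hypothesis applies. *)
    + apply Cn_on_ext with (fun t x => - (dt f t x * (/ f t x * / f t x))); auto.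
      * intros t x Hx; specialize (Hnz t x Hx); unfold dt.
        rewrite (Derive_inv (fun s => f s x) t (proj1 (F1 t x Hx)) Hnz).
        field; exact Hnz.
      * apply Cn_on_opp; auto; repeat apply Cn_on_mult; auto.
    + apply Cn_on_ext with (fun t x => - (dx f t x * (/ f t x * / f t x))); auto.
      * intros t x Hx; specialize (Hnz t x Hx); unfold dx.
        rewrite (Derive_inv (fun y => f t y) x (proj2 (F1 t x Hx)) Hnz).
        field; exact Hnz.
      * apply Cn_on_opp; auto; repeat apply Cn_on_mult; auto.
Qed.

Lemma smooth_const (U : R -> R -> Prop) (c : R) : smooth_on U (fun _ _ => c).
Proof. intros n; apply Cn_on_const. Qed.

Lemma smooth_plus (U : R -> R -> Prop) (f g : R -> R -> R) :
  open2 U -> smooth_on U f -> smooth_on U g -> smooth_on U (fun t x => f t x + g t x).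
Proof. intros HU Hf Hg n; exact (Cn_on_plus n U f g HU (Hf n) (Hg n)). Qed.

Lemma smooth_mult (U : R -> R -> Prop) (f g : R -> R -> R) :
  open2 U -> smooth_on U f -> smooth_on U g -> smooth_on U (fun t x => f t x * g t x).
Proof. intros HU Hf Hg n; exact (Cn_on_mult n U f g HU (Hf n) (Hg n)). Qed.

Lemma smooth_opp (U : R -> R -> Prop) (f : R -> R -> R) :
  open2 U -> smooth_on U f -> smooth_on U (fun t x => - f t x).
Proof. intros HU Hf n; exact (Cn_on_opp n U f HU (Hf n)). Qed.

Lemma smooth_minus (U : R -> R -> Prop) (f g : R -> R -> R) :
  open2 U -> smooth_on U f -> smooth_on U g -> smooth_on U (fun t x => f t x - g t x).
Proof. intros HU Hf Hg; apply smooth_plus; auto; now apply smooth_opp. Qed.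

Lemma smooth_div (U : R -> R -> Prop) (f g : R -> R -> R) :
  open2 U -> (forall t x, U t x -> g t x <> 0) ->
  smooth_on U f -> smooth_on U g -> smooth_on U (fun t x => f t x / g t x).
Proof.
  intros HU Hnz Hf Hg; apply smooth_mult; auto.
  intros n; exact (Cn_on_inv n U g HU Hnz (Hg n)).
Qed.

Lemma smooth_dt (U : R -> R -> Prop) (f : R -> R -> R) :
  smooth_on U f -> smooth_on U (dt f).
Proof. intros Hf n; apply (proj1 (Cn_on_S n U f)); exact (Hf (S n)). Qed.

Lemma smooth_dx (U : R -> R -> Prop) (f : R -> R -> R) :
  smooth_on U f -> smooth_on U (dx f).
Proof. intros Hf n; apply (proj1 (Cn_on_S n U f)); exact (Hf (S n)). Qed.

Lemma smooth_sub (U D : R -> R -> Prop) (f : R -> R -> R) :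
  subdom U D -> smooth_on D f -> smooth_on U f.
Proof. intros HU Hf n t x Hx; apply Hf; auto. Qed.

Lemma smooth_continuity (U : R -> R -> Prop) (f : R -> R -> R) (t x : R) :
  smooth_on U f -> U t x -> continuity_2d_pt f t x.
Proof. intros Hf Hx; apply (Hf O t x Hx). Qed.

Lemma smooth_ex_dt (U : R -> R -> Prop) (f : R -> R -> R) (t x : R) :
  smooth_on U f -> U t x -> ex_derive (fun s => f s x) t.
Proof. intros Hf Hx; apply (Hf 1%nat t x Hx). Qed.

Lemma smooth_ex_dx (U : R -> R -> Prop) (f : R -> R -> R) (t x : R) :
  smooth_on U f -> U t x -> ex_derive (fun y => f t y) x.
Proof. intros Hf Hx; apply (Hf 1%nat t x Hx). Qed.

Lemma smooth_schwarz (U : R -> R -> Prop) (f : R -> R -> R) (t x : R) :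
  open2 U -> smooth_on U f -> U t x -> dt (dx f) t x = dx (dt f) t x.
Proof.
  intros HU Hf Hx; apply Schwarz.
  - destruct (HU t x Hx) as [d Hd]; exists d; intros s y Hs Hy.
    assert (Hsy := Hd s y Hs Hy).
    split; [|split; [|split]].
    + now apply (smooth_ex_dt U f).
    + now apply (smooth_ex_dx U f).
    + apply (smooth_ex_dt U (dx f)); auto using smooth_dx.
    + apply (smooth_ex_dx U (dt f)); auto using smooth_dt.
  - apply (smooth_continuity U (dt (dx f))); auto using smooth_dx, smooth_dt.
  - apply (smooth_continuity U (dx (dt f))); auto using smooth_dx, smooth_dt.
Qed.

(* Quantifying over all large K and all small r lets finitely many functions share
   one constant and one box. *)
Definition eventually_small (P : R -> R -> Prop) : Prop :=
  exists K0 r0, 0 < r0 /\ forall K r, K0 <= K -> 0 < r <= r0 -> P K r.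

Lemma eventually_small_and (P Q : R -> R -> Prop) :
  eventually_small P -> eventually_small Q -> eventually_small (fun K r => P K r /\ Q K r).
Proof.
  intros [K1 [r1 [H1 HP]]] [K2 [r2 [H2 HQ]]].
  exists (Rmax K1 K2), (Rmin r1 r2); split; [now apply Rmin_pos|].
  intros K r HK Hr.
  assert (A1 := Rmax_l K1 K2); assert (A2 := Rmax_r K1 K2).
  assert (A3 := Rmin_l r1 r2); assert (A4 := Rmin_r r1 r2).
  split; [apply HP | apply HQ]; lra.
Qed.

Lemma eventually_subdom (D : R -> R -> Prop) (t0 x0 : R) :
  open2 D -> D t0 x0 -> eventually_small (fun _ r => subdom (box t0 x0 r) D).
Proof.
  intros HD Hx; destruct (HD t0 x0 Hx) as [d Hd].
  exists 0, d; split; [apply cond_pos|]; intros K r _ Hr t x [H1 H2].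
  apply Hd; lra.
Qed.

Lemma eventually_bounded (f : R -> R -> R) (t0 x0 : R) :
  continuity_2d_pt f t0 x0 ->
  eventually_small (fun K r => bounded_on (box t0 x0 r) K f).
Proof.
  intros Hf; destruct (Hf (mkposreal 1 Rlt_0_1)) as [d Hd]; simpl in Hd.
  exists (Rabs (f t0 x0) + 1), d; split; [apply cond_pos|].
  intros K r HK Hr t x [Ht Hx].
  specialize (Hd t x ltac:(lra) ltac:(lra)).
  assert (H := Rabs_triang (f t x - f t0 x0) (f t0 x0)).
  replace (f t x - f t0 x0 + f t0 x0) with (f t x) in H by ring; lra.
Qed.

Lemma eventually_tame_on (D : R -> R -> Prop) (f : R -> R -> R) (t0 x0 : R) :
  open2 D -> D t0 x0 -> smooth_on D f ->
  eventually_small (fun K r => tame_on (box t0 x0 r) K f).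
Proof.
  intros HD Hx Hf.
  destruct (eventually_small_and _ _ (eventually_subdom D t0 x0 HD Hx)
              (eventually_bounded f t0 x0 (smooth_continuity D f t0 x0 Hf Hx)))
    as [K0 [r0 [Hr0 H]]].
  exists K0, r0; split; auto; intros K r HK Hr.
  destruct (H K r HK Hr) as [H1 H2]; intros t x Htx; split; [|split]; auto.
  - apply (smooth_ex_dt D f); auto.
  - apply (smooth_ex_dx D f); auto.
Qed.

Lemma eventually_t_tame_on (D : R -> R -> Prop) (f : R -> R -> R) (t0 x0 : R) :
  open2 D -> D t0 x0 -> smooth_on D f ->
  eventually_small (fun K r => t_tame_on (box t0 x0 r) K f).
Proof.
  intros HD Hx Hf.
  apply eventually_small_and; [now apply eventually_tame_on with D|].
  apply eventually_small_and; [apply eventually_tame_on with D; auto using smooth_dt|].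
  apply eventually_bounded, (smooth_continuity D); auto using smooth_dt.
Qed.

(** * Smooth local solutions of compatible total systems *)

(** Partial derivatives alone do not give joint continuity. Here one moves first in [t] on the line
    through the point, by continuity there, and then in [x], with the Lipschitz constant [M] uniform
    in [t]. *)
Lemma continuity_2d_pt_bounded_dx (t0 x0 r M : R) (u u' : R -> R -> R) :
  (forall t x, box t0 x0 r t x -> ex_derive (fun s => u s x) t /\
     is_derive (fun y => u t y) x (u' t x) /\ Rabs (u' t x) <= M) ->
  forall t x, box t0 x0 r t x -> continuity_2d_pt u t x.
Proof.
  intros H t x Htx eps.
  assert (HM : 0 <= M).
  { destruct (H t x Htx) as [_ [_ HM]]; eapply Rle_trans; [apply Rabs_pos | exact HM]. }
  assert (Hc : continuity_pt (fun s => u s x) t).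
  { apply continuity_pt_filterlim.
    exact (ex_derive_continuous (V := R_NormedModule) (fun s => u s x) t
             (proj1 (H t x Htx))). }
  assert (He : 0 < eps / 2) by (apply is_pos_div_2).
  destruct (proj1 (continuity_pt_locally _ _) Hc (mkposreal _ He)) as [d1 H1].
  destruct (box_open t0 x0 r t x Htx) as [d2 H2].
  assert (He' : 0 < eps / (2 * (M + 1))) by
    (apply Rdiv_lt_0_compat; [apply cond_pos | lra]).
  assert (Hd : 0 < Rmin (Rmin d1 d2) (eps / (2 * (M + 1)))).
  { repeat apply Rmin_pos; auto; apply cond_pos. }
  exists (mkposreal _ Hd); simpl; intros s y Hs Hy.
  assert (Hs1 : Rabs (s - t) < d1)
    by (eapply Rlt_le_trans; [exact Hs | eapply Rle_trans; [apply Rmin_l | apply Rmin_l]]).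
  assert (Hs2 : Rabs (s - t) < d2)
    by (eapply Rlt_le_trans; [exact Hs | eapply Rle_trans; [apply Rmin_l | apply Rmin_r]]).
  assert (Hy2 : Rabs (y - x) < d2)
    by (eapply Rlt_le_trans; [exact Hy | eapply Rle_trans; [apply Rmin_l | apply Rmin_r]]).
  assert (Hy3 : Rabs (y - x) < eps / (2 * (M + 1)))
    by (eapply Rlt_le_trans; [exact Hy | apply Rmin_r]).
  assert (A1 : Rabs (u s x - u t x) < eps / 2) by (apply (H1 s); exact Hs1).
  assert (A2 : Rabs (u s y - u s x) <= M * Rabs (y - x)).
  { assert (Hb : forall z, Rmin x y <= z <= Rmax x y -> box t0 x0 r s z).
    { intros z Hz; apply H2; auto; eapply Rle_lt_trans; [|exact Hy2].
      revert Hz; unfold Rmin, Rmax, Rabs; repeat destruct Rle_dec;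
        repeat destruct Rcase_abs; lra. }
    apply is_derive_bounded_variation with (u' s).
    - intros z Hz; exact (proj1 (proj2 (H s z (Hb z Hz)))).
    - intros z Hz; exact (proj2 (proj2 (H s z (Hb z Hz)))). }
  replace (u s y - u t x) with ((u s y - u s x) + (u s x - u t x)) by ring.
  eapply Rle_lt_trans; [apply Rabs_triang|].
  assert (M * Rabs (y - x) <= eps / 2).
  { apply Rle_trans with ((M + 1) * (eps / (2 * (M + 1)))).
    - assert (A3 := Rabs_pos (y - x)); nra.
    - right; field; lra. }
  lra.
Qed.

Lemma total_solution_partials (U : R -> R -> Prop)
    (a b c k l m al be ga u p : R -> R -> R) (t x : R) :
  total_solution U a b c k l m al be ga u p -> U t x ->
  dx u t x = p t x /\
  dx p t x = a t x * u t x + b t x * p t x + c t x /\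
  dt u t x = k t x * u t x + l t x * p t x + m t x /\
  dt p t x = al t x * u t x + be t x * p t x + ga t x.
Proof.
  intros H Hx; destruct (H t x Hx) as [H1 [H2 [H3 H4]]].
  repeat split; now apply is_derive_unique.
Qed.

(** Bootstrap: the system expresses all first partials of the pair as smooth affine combinations of
    the pair, so each order of regularity gives the next. Joint continuity starts the induction. *)
Lemma total_solution_smooth (U : R -> R -> Prop)
    (a b c k l m al be ga u p : R -> R -> R) :
  open2 U ->
  smooth_on U a -> smooth_on U b -> smooth_on U c ->
  smooth_on U k -> smooth_on U l -> smooth_on U m ->
  smooth_on U al -> smooth_on U be -> smooth_on U ga ->
  total_solution U a b c k l m al be ga u p ->
  (forall t x, U t x -> continuity_2d_pt u t x /\ continuity_2d_pt p t x) ->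
  smooth_on U u /\ smooth_on U p.
Proof.
  intros HU Ha Hb Hc Hk Hl Hm Hal Hbe Hga H Hcont.
  assert (Hn : forall n, Cn_on n U u /\ Cn_on n U p).
  { assert (H0 : Cn_on 0 U u /\ Cn_on 0 U p).
    { split; intros t x Hx; split; auto; now apply Hcont. }
    assert (Hp : partials_on U u /\ partials_on U p).
    { split; intros t x Hx; destruct (H t x Hx) as [H1 [H2 [H3 H4]]];
        split; eexists; eassumption. }
    induction n as [|n [IHu IHp]]; [exact H0|].
    assert (Hlin : forall f g h : R -> R -> R,
              smooth_on U f -> smooth_on U g -> smooth_on U h ->
              Cn_on n U (fun t x => f t x * u t x + g t x * p t x + h t x)).
    { intros f g h Hf Hg Hh.
      apply Cn_on_plus; [auto | apply Cn_on_plus; auto; apply Cn_on_mult; auto |];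
        intros t x Hx; auto. }
    split; apply Cn_on_S; (split; [apply H0 | split; [apply Hp | split]]).
    - eapply Cn_on_ext; [auto | | apply (Hlin k l m); auto].
      intros t x Hx; symmetry; eapply total_solution_partials; eauto.
    - eapply Cn_on_ext; [auto | | exact IHp].
      intros t x Hx; symmetry; eapply total_solution_partials; eauto.
    - eapply Cn_on_ext; [auto | | apply (Hlin al be ga); auto].
      intros t x Hx; symmetry; eapply total_solution_partials; eauto.
    - eapply Cn_on_ext; [auto | | apply (Hlin a b c); auto].
      intros t x Hx; symmetry; eapply total_solution_partials; eauto. }
  split; intros n; apply Hn.
Qed.

(** The radius is chosen before the initial values, so solutions with different initial values share
    one box. *)
Lemma smooth_frobenius (D : R -> R -> Prop) (t0 x0 : R)
    (a b c k l m al be ga : R -> R -> R) :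
  open2 D -> D t0 x0 ->
  smooth_on D a -> smooth_on D b -> smooth_on D c ->
  smooth_on D k -> smooth_on D l -> smooth_on D m ->
  smooth_on D al -> smooth_on D be -> smooth_on D ga ->
  compatible_on D a b c k l m al be ga ->
  exists r, 0 < r /\ subdom (box t0 x0 r) D /\
    forall u0 p0, exists u p : R -> R -> R, u t0 x0 = u0 /\ p t0 x0 = p0 /\
      total_solution (box t0 x0 r) a b c k l m al be ga u p /\
      smooth_on (box t0 x0 r) u /\ smooth_on (box t0 x0 r) p.
Proof.
  intros HD Hx Ha Hb Hc Hk Hl Hm Hal Hbe Hga Hcomp.
  assert (HT := fun f Hf => eventually_tame_on D f t0 x0 HD Hx Hf).
  assert (HTt := fun f Hf => eventually_t_tame_on D f t0 x0 HD Hx Hf).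
  destruct (eventually_small_and _ _ (eventually_subdom D t0 x0 HD Hx)
    (eventually_small_and _ _ (HTt a Ha) (eventually_small_and _ _ (HTt b Hb)
    (eventually_small_and _ _ (HTt c Hc) (eventually_small_and _ _ (HT k Hk)
    (eventually_small_and _ _ (HT l Hl) (eventually_small_and _ _ (HT m Hm)
    (eventually_small_and _ _ (HT al Hal) (eventually_small_and _ _ (HT be Hbe)
       (HT ga Hga)))))))))) as [K0 [r0 [Hr0 H]]].
  (* The equation [u_x = p] has a coefficient 1, which [K] must also bound; [/ (4 * K)] enforces
     [4 * r * K <= 1]. *)
  set (K := Rmax 1 K0); set (r := Rmin r0 (/ (4 * K))).
  assert (HK1 : 1 <= K) by apply Rmax_l.
  assert (HK0 : K0 <= K) by apply Rmax_r.
  assert (Hi : 0 < / (4 * K)) by (apply Rinv_0_lt_compat; lra).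
  assert (Hr : 0 < r) by (now apply Rmin_pos).
  assert (Hrr : r <= r0) by apply Rmin_l.
  assert (HrK : 4 * r * K <= 1).
  { assert (r <= / (4 * K)) by apply Rmin_r.
    apply Rle_trans with (4 * / (4 * K) * K); [nra | right; field; lra]. }
  destruct (H K r HK0 (conj Hr Hrr)) as [S [Ta [Tb [Tc [Tk [Tl [Tm [Tal [Tbe Tga]]]]]]]]].
  exists r; split; [auto|]; split; [auto|]; intros u0 p0.
  destruct (frobenius t0 x0 r K u0 p0 a b c k l m al be ga)
    as [u [p [M [Hu0 [Hp0 [Hsol [HMu HMp]]]]]]]; auto.
  { intros t y Hy; apply Hcomp; auto. }
  exists u, p; split; [auto|]; split; [auto|]; split; [auto|].
  apply (total_solution_smooth _ a b c k l m al be ga);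
    auto using box_open; try (apply smooth_sub with D; auto; fail).
  intros t y Hy; split.
  - apply (continuity_2d_pt_bounded_dx t0 x0 r M u p); auto.
    intros s z Hz; destruct (Hsol s z Hz) as [H1 [H2 [H3 H4]]].
    split; [eexists; eassumption|]; split; auto.
  - apply (continuity_2d_pt_bounded_dx t0 x0 r (K * (M + M) + K) p
             (fun t x => a t x * u t x + b t x * p t x + c t x)); auto.
    intros s z Hz; destruct (Hsol s z Hz) as [H1 [H2 [H3 H4]]].
    split; [eexists; eassumption|]; split; auto.
    assert (Ta' := proj1 Ta); assert (Tb' := proj1 Tb); assert (Tc' := proj1 Tc).
    eapply Rle_trans; [apply Rabs_affine_le with (K := K); eapply tame_le; eauto|].
    apply Rplus_le_compat; [|eapply tame_le; eauto].
    apply Rmult_le_compat_l; [lra|]; apply Rplus_le_compat; auto.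
Qed.

(** * The total differential system of an invariant solution *)

(** Liouville: numerator and denominator are Wronskians of the same linear system, so both satisfy
    [W' = (m11 + m22) W]. A general matrix is used so that the lemma applies along [x] and along
    [t]. *)
Lemma ratio_of_wronskians_derive (q s v1 p1 v2 p2 : R -> R) (x m11 m12 m21 m22 : R) :
  is_derive q x (m11 * q x + m12 * s x) -> is_derive s x (m21 * q x + m22 * s x) ->
  is_derive v1 x (m11 * v1 x + m12 * p1 x) -> is_derive p1 x (m21 * v1 x + m22 * p1 x) ->
  is_derive v2 x (m11 * v2 x + m12 * p2 x) -> is_derive p2 x (m21 * v2 x + m22 * p2 x) ->
  v1 x * p2 x - p1 x * v2 x <> 0 ->
  is_derive (fun y => (q y * p2 y - s y * v2 y) / (v1 y * p2 y - p1 y * v2 y)) x 0.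
Proof.
  intros Hq Hs Hv1 Hp1 Hv2 Hp2 HW.
  auto_derive.
  - repeat split; auto; eexists; eassumption.
  - change (fun y : R => q y) with q; change (fun y : R => s y) with s;
      change (fun y : R => v1 y) with v1; change (fun y : R => p1 y) with p1;
      change (fun y : R => v2 y) with v2; change (fun y : R => p2 y) with p2.
    rewrite (is_derive_unique q _ _ Hq), (is_derive_unique s _ _ Hs),
      (is_derive_unique v1 _ _ Hv1), (is_derive_unique p1 _ _ Hp1),
      (is_derive_unique v2 _ _ Hv2), (is_derive_unique p2 _ _ Hp2).
    field; exact HW.
Qed.

Lemma constant_on_box (t0 x0 r : R) (f : R -> R -> R) :
  (forall t x, box t0 x0 r t x ->
     is_derive (fun s => f s x) t 0 /\ is_derive (fun y => f t y) x 0) ->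
  forall t x, box t0 x0 r t x -> f t x = f t0 x0.
Proof.
  intros H t x [Ht Hx].
  assert (Hr : 0 < r) by (eapply Rle_lt_trans; [apply Rabs_pos | exact Ht]).
  assert (E1 : Rabs (f t x - f t x0) <= 0 * Rabs (x - x0)).
  { apply (is_derive_bounded_variation (f t) (fun _ => 0)).
    - intros y Hy; refine (proj2 (H t y _)); split; auto; eapply between_center; eauto.
    - intros; rewrite Rabs_R0; lra. }
  assert (E2 : Rabs (f t x0 - f t0 x0) <= 0 * Rabs (t - t0)).
  { apply (is_derive_bounded_variation (fun s => f s x0) (fun _ => 0)).
    - intros s Hs; refine (proj1 (H s x0 _)); split; [eapply between_center; eauto|].
      now rewrite Rminus_diag, Rabs_R0.
    - intros; rewrite Rabs_R0; lra. }
  assert (P1 := Rabs_pos (f t x - f t x0)); assert (P2 := Rabs_pos (f t x0 - f t0 x0)).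
  assert (Z1 := Rabs_eq_0 (f t x - f t x0) ltac:(lra)).
  assert (Z2 := Rabs_eq_0 (f t x0 - f t0 x0) ltac:(lra)).
  lra.
Qed.

Definition homogeneous_solution (U : R -> R -> Prop)
    (a b k l al be u p : R -> R -> R) : Prop :=
  total_solution U a b (fun _ _ => 0) k l (fun _ _ => 0) al be (fun _ _ => 0) u p.

(** Cramer's rule at each point gives the coefficients [f1] and [f2] as ratios of Wronskians, and
    both partial derivatives of such a ratio vanish. *)
Lemma homogeneous_span (s y rho : R) (a b k l al be q w v1 p1 v2 p2 : R -> R -> R) :
  homogeneous_solution (box s y rho) a b k l al be q w ->
  homogeneous_solution (box s y rho) a b k l al be v1 p1 ->
  homogeneous_solution (box s y rho) a b k l al be v2 p2 ->
  (forall t x, box s y rho t x -> v1 t x * p2 t x - p1 t x * v2 t x <> 0) ->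
  exists c1 c2 : R, forall t x, box s y rho t x ->
    q t x = c1 * v1 t x + c2 * v2 t x.
Proof.
  intros Hq H1 H2 HW.
  set (f1 := fun t x => (q t x * p2 t x - w t x * v2 t x)
                        / (v1 t x * p2 t x - p1 t x * v2 t x)).
  (* Both signs are reversed, so that [f2] is [f1] with the two basis solutions exchanged and the
     same lemma differentiates it. *)
  set (f2 := fun t x => (q t x * p1 t x - w t x * v1 t x)
                        / (v2 t x * p1 t x - p2 t x * v1 t x)).
  assert (Hx : forall u p t x,
            homogeneous_solution (box s y rho) a b k l al be u p -> box s y rho t x ->
            is_derive (fun z => u t z) x (0 * u t x + 1 * p t x) /\
            is_derive (fun z => p t z) x (a t x * u t x + b t x * p t x) /\
            is_derive (fun z => u z x) t (k t x * u t x + l t x * p t x) /\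
            is_derive (fun z => p z x) t (al t x * u t x + be t x * p t x)).
  { intros u p t x Hu Htx; destruct (Hu t x Htx) as [E1 [E2 [E3 E4]]].
    rewrite Rplus_0_r in E2, E3, E4.
    rewrite Rmult_0_l, Rmult_1_l, Rplus_0_l; auto. }
  exists (f1 s y), (f2 s y); intros t x Htx.
  rewrite <- (constant_on_box s y rho f1) with (t := t) (x := x),
    <- (constant_on_box s y rho f2) with (t := t) (x := x); auto.
  - assert (HWx := HW t x Htx); unfold f1, f2; field; split; auto.
    intros E; apply HWx; lra.
  - clear t x Htx; intros t x Htx.
    destruct (Hx _ _ t x Hq Htx) as [A1 [A2 [A3 A4]]].
    destruct (Hx _ _ t x H1 Htx) as [B1 [B2 [B3 B4]]].
    destruct (Hx _ _ t x H2 Htx) as [C1 [C2 [C3 C4]]].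
    assert (HWx : v2 t x * p1 t x - p2 t x * v1 t x <> 0)
      by (intros E; apply (HW t x Htx); lra).
    split; eapply ratio_of_wronskians_derive; eassumption.
  - clear t x Htx; intros t x Htx.
    destruct (Hx _ _ t x Hq Htx) as [A1 [A2 [A3 A4]]].
    destruct (Hx _ _ t x H1 Htx) as [B1 [B2 [B3 B4]]].
    destruct (Hx _ _ t x H2 Htx) as [C1 [C2 [C3 C4]]].
    assert (HWx := HW t x Htx).
    split; eapply ratio_of_wronskians_derive; eassumption.
Qed.

Lemma total_solution_minus (U : R -> R -> Prop)
    (a b c k l m al be ga u p u' p' : R -> R -> R) :
  total_solution U a b c k l m al be ga u p ->
  total_solution U a b c k l m al be ga u' p' ->
  homogeneous_solution U a b k l al be
    (fun t x => u t x - u' t x) (fun t x => p t x - p' t x).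
Proof.
  intros H H' t x Hx.
  destruct (H t x Hx) as [E1 [E2 [E3 E4]]]; destruct (H' t x Hx) as [F1 [F2 [F3 F4]]].
  split; [|split; [|split]].
  - exact (is_derive_minus (V := R_NormedModule) _ _ _ _ _ E1 F1).
  - replace (a t x * (u t x - u' t x) + b t x * (p t x - p' t x) + 0)
      with (a t x * u t x + b t x * p t x + c t x
            - (a t x * u' t x + b t x * p' t x + c t x)) by ring.
    exact (is_derive_minus (V := R_NormedModule) _ _ _ _ _ E2 F2).
  - replace (k t x * (u t x - u' t x) + l t x * (p t x - p' t x) + 0)
      with (k t x * u t x + l t x * p t x + m t x
            - (k t x * u' t x + l t x * p' t x + m t x)) by ring.
    exact (is_derive_minus (V := R_NormedModule) _ _ _ _ _ E3 F3).
  - replace (al t x * (u t x - u' t x) + be t x * (p t x - p' t x) + 0)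
      with (al t x * u t x + be t x * p t x + ga t x
            - (al t x * u' t x + be t x * p' t x + ga t x)) by ring.
    exact (is_derive_minus (V := R_NormedModule) _ _ _ _ _ E4 F4).
Qed.

(* Eliminating u_t between the equation L and the invariant surface condition
   u_t + g^1 u_x = g^2 u + h gives A u_xx = -(B + g^1) u_x + (g^2 - C) u + h;
   with p = u_x this and its differential consequences form the total system
   below, in which h = g^3 or h = 0. *)
Definition red_a (A C : R -> R -> R) (g : idx3 -> R -> R -> R) t x :=
  (g i2 t x - C t x) / A t x.
Definition red_b (A B : R -> R -> R) (g : idx3 -> R -> R -> R) t x :=
  - (B t x + g i1 t x) / A t x.
Definition red_l (g : idx3 -> R -> R -> R) t x := - g i1 t x.
(** [red_al], [red_be] and [red_ga] are the coefficients of [p_t = d_x (g^2 u - g^1 p + h)] after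
    [p_x] is eliminated by the second-order equation. *)
Definition red_al (A C : R -> R -> R) (g : idx3 -> R -> R -> R) t x :=
  dx (g i2) t x + red_l g t x * red_a A C g t x.
Definition red_be (A B : R -> R -> R) (g : idx3 -> R -> R -> R) t x :=
  g i2 t x + dx (red_l g) t x + red_l g t x * red_b A B g t x.
Definition red_c (A h : R -> R -> R) t x := h t x / A t x.
Definition red_ga (A : R -> R -> R) (g : idx3 -> R -> R -> R) (h : R -> R -> R) t x :=
  red_l g t x * red_c A h t x + dx h t x.

Definition reduced_solution (U : R -> R -> Prop) (A B C : R -> R -> R)
    (g : idx3 -> R -> R -> R) (h u p : R -> R -> R) : Prop :=
  total_solution U (red_a A C g) (red_b A B g) (red_c A h) (g i2) (red_l g) h
    (red_al A C g) (red_be A B g) (red_ga A g h) u p.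

Ltac smooth_ex_derive D :=
  match goal with
  | |- ex_derive (fun _ => ?f _ ?x) ?t => apply (smooth_ex_dt D f); auto
  | |- ex_derive (fun _ => ?f ?t _) ?x => apply (smooth_ex_dx D f); auto
  | |- ex_derive (?f ?t) ?x => apply (smooth_ex_dx D f); auto
  end.

Ltac side_conditions D :=
  repeat match goal with |- _ /\ _ => split end;
  first [exact I | assumption | smooth_ex_derive D; auto using smooth_dx, smooth_dt].

(** The first three compatibility conditions hold by the definition of [red_al], [red_be] and
    [red_ga]. The remaining three are, up to the factor [1 / A] and a sign, the second, first and
    third equations of [DE1]. *)
Lemma DE1_compatible (D : R -> R -> Prop) (A B C : R -> R -> R)
    (g : idx3 -> R -> R -> R) :
  open2 D -> smooth_on D A -> smooth_on D B -> smooth_on D C ->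
  (forall t x, D t x -> A t x <> 0) -> (forall i, smooth_on D (g i)) ->
  solves D (DE1 A B C) g ->
  compatible_on D (red_a A C g) (red_b A B g) (red_c A (g i3)) (g i2) (red_l g) (g i3)
    (red_al A C g) (red_be A B g) (red_ga A g (g i3)).
Proof.
  intros HD HA HB HC HA0 Hg HDE t x Hx.
  assert (Hnz := HA0 t x Hx).
  assert (E1 := HDE t x Hx i1); assert (E2 := HDE t x Hx i2);
    assert (E3 := HDE t x Hx i3).
  unfold DE1, jet in E1, E2, E3; cbv beta iota zeta delta [jt jx jw jw_t jw_x jw_xx]
    in E1, E2, E3.
  assert (Rlx : forall s y, D s y -> dx (red_l g) s y = - dx (g i1) s y).
  { intros s y Hs; unfold red_l, dx; apply Derive_opp. }
  assert (Rax : dx (red_a A C g) t x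
          = (dx (g i2) t x - dx C t x) / A t x
            - (g i2 t x - C t x) * dx A t x / (A t x * A t x)).
  { apply is_derive_unique; unfold red_a; auto_derive.
    - side_conditions D.
    - unfold dx; field; auto. }
  assert (Rat : dt (red_a A C g) t x
          = (dt (g i2) t x - dt C t x) / A t x
            - (g i2 t x - C t x) * dt A t x / (A t x * A t x)).
  { apply is_derive_unique; unfold red_a; auto_derive.
    - side_conditions D.
    - unfold dt; field; auto. }
  assert (Rbx : dx (red_b A B g) t x
          = - (dx B t x + dx (g i1) t x) / A t x
            + (B t x + g i1 t x) * dx A t x / (A t x * A t x)).
  { apply is_derive_unique; unfold red_b; auto_derive.
    - side_conditions D.
    - unfold dx; field; auto. }
  assert (Rbt : dt (red_b A B g) t x
          = - (dt B t x + dt (g i1) t x) / A t x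
            + (B t x + g i1 t x) * dt A t x / (A t x * A t x)).
  { apply is_derive_unique; unfold red_b; auto_derive.
    - side_conditions D.
    - unfold dt; field; auto. }
  assert (Rcx : dx (red_c A (g i3)) t x
          = dx (g i3) t x / A t x - g i3 t x * dx A t x / (A t x * A t x)).
  { apply is_derive_unique; unfold red_c; auto_derive.
    - side_conditions D.
    - unfold dx; field; auto. }
  assert (Rct : dt (red_c A (g i3)) t x
          = dt (g i3) t x / A t x - g i3 t x * dt A t x / (A t x * A t x)).
  { apply is_derive_unique; unfold red_c; auto_derive.
    - side_conditions D.
    - unfold dt; field; auto. }
  assert (Sa : smooth_on D (red_a A C g))
    by (apply smooth_div; auto; apply smooth_minus; auto).
  assert (Sb : smooth_on D (red_b A B g))
    by (apply smooth_div; auto; apply smooth_opp; auto; apply smooth_plus; auto).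
  assert (Sc : smooth_on D (red_c A (g i3))) by (apply smooth_div; auto).
  assert (Sl : smooth_on D (red_l g)) by (apply smooth_opp; auto).
  assert (Rlxx : dx (dx (red_l g)) t x = - dx (dx (g i1)) t x).
  { rewrite (dx_ext_on D _ (fun s y => - dx (g i1) s y) HD Rlx t x Hx).
    apply Derive_opp. }
  assert (Ralx : dx (red_al A C g) t x
          = dx (dx (g i2)) t x + (dx (red_l g) t x * red_a A C g t x
            + red_l g t x * dx (red_a A C g) t x)).
  { apply is_derive_unique; unfold red_al; auto_derive.
    - side_conditions D.
    - unfold dx; ring. }
  assert (Rbex : dx (red_be A B g) t x
          = dx (g i2) t x + dx (dx (red_l g)) t x + (dx (red_l g) t x * red_b A B g t x
            + red_l g t x * dx (red_b A B g) t x)).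
  { apply is_derive_unique; unfold red_be; auto_derive.
    - side_conditions D.
    - unfold dx; ring. }
  assert (Rgax : dx (red_ga A g (g i3)) t x
          = (dx (red_l g) t x * red_c A (g i3) t x
            + red_l g t x * dx (red_c A (g i3)) t x) + dx (dx (g i3)) t x).
  { apply is_derive_unique; unfold red_ga; auto_derive.
    - side_conditions D.
    - unfold dx; ring. }
  assert (T1 : dt (g i1) t x = A t x * dx (dx (g i1)) t x + B t x * dx (g i1) t x
    - (2 * dx (g i1) t x - dx A t x / A t x * g i1 t x - dt A t x / A t x)
      * (g i1 t x + B t x) - dx B t x * g i1 t x - 2 * A t x * dx (g i2) t x - dt B t x)
    by lra.
  assert (T2 : dt (g i2) t x = A t x * dx (dx (g i2)) t x + B t x * dx (g i2) t x
    - (2 * dx (g i1) t x - dx A t x / A t x * g i1 t x - dt A t x / A t x)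
      * (g i2 t x - C t x) + dx C t x * g i1 t x + dt C t x)
    by lra.
  assert (T3 : dt (g i3) t x = A t x * dx (dx (g i3)) t x + B t x * dx (g i3) t x
    - (2 * dx (g i1) t x - dx A t x / A t x * g i1 t x - dt A t x / A t x) * g i3 t x
    + C t x * g i3 t x)
    by lra.
  split; [reflexivity|]; split; [reflexivity|]; split; [reflexivity|].
  rewrite Ralx, Rbex, Rgax, Rlxx, Rax, Rbx, Rcx, Rat, Rbt, Rct, T1, T2, T3.
  unfold red_al, red_be, red_ga; rewrite (Rlx t x Hx).
  unfold red_a, red_b, red_c, red_l.
  split; [|split]; field; auto.
Qed.

(** The [p_t] equation is the [x]-derivative of the invariance condition, by equality of mixed
    derivatives. The term [h] is general: it is [g^3] for an R-invariant solution and 0 for a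
    characteristic. *)
Lemma reduced_solution_of_invariant (U : R -> R -> Prop) (A B C : R -> R -> R)
    (g : idx3 -> R -> R -> R) (h u : R -> R -> R) :
  open2 U -> smooth_on U u -> (forall i, smooth_on U (g i)) -> smooth_on U h ->
  (forall t x, U t x -> A t x <> 0) ->
  (forall t x, U t x ->
     dt u t x = A t x * dx (dx u) t x + B t x * dx u t x + C t x * u t x) ->
  (forall t x, U t x -> dt u t x + g i1 t x * dx u t x = g i2 t x * u t x + h t x) ->
  reduced_solution U A B C g h u (dx u).
Proof.
  intros HU Hu Hg Hh HA HL HR t x Hx.
  assert (Hnz := HA t x Hx).
  assert (Hxx : forall s y, U s y -> dx (dx u) s y
          = red_a A C g s y * u s y + red_b A B g s y * dx u s y + red_c A h s y).
  { intros s y Hs; unfold red_a, red_b, red_c.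
    assert (E1 := HL s y Hs); assert (E2 := HR s y Hs).
    apply Rmult_eq_reg_l with (A s y); auto.
    transitivity ((g i2 s y - C s y) * u s y - (B s y + g i1 s y) * dx u s y + h s y);
      [lra | field; auto]. }
  assert (Ht : forall s y, U s y -> dt u s y
          = g i2 s y * u s y + red_l g s y * dx u s y + h s y).
  { intros s y Hs; unfold red_l; assert (E2 := HR s y Hs); lra. }
  assert (Sl : smooth_on U (red_l g)) by (apply smooth_opp; auto).
  split; [|split; [|split]].
  - apply Derive_correct; apply (smooth_ex_dx U); auto.
  - rewrite <- (Hxx t x Hx); apply Derive_correct; apply (smooth_ex_dx U (dx u));
      auto using smooth_dx.
  - rewrite <- (Ht t x Hx); apply Derive_correct; apply (smooth_ex_dt U u); auto.
  - replace (red_al A C g t x * u t x + red_be A B g t x * dx u t x + red_ga A g h t x)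
      with (dt (dx u) t x).
    { apply Derive_correct; apply (smooth_ex_dt U (dx u)); auto using smooth_dx. }
    rewrite (smooth_schwarz U u t x HU Hu Hx), (dx_ext_on U _ _ HU Ht t x Hx).
    transitivity (dx (g i2) t x * u t x + g i2 t x * dx u t x
      + (dx (red_l g) t x * dx u t x + red_l g t x * dx (dx u) t x) + dx h t x).
    + apply is_derive_unique, derive_linear_combination;
        try (apply Derive_correct);
        side_conditions U.
    + rewrite (Hxx t x Hx); unfold red_al, red_be, red_ga; ring.
Qed.

(** * Lie symmetries *)

(** The jet shift moves the base point too, so [A], [B] and [C] are differentiated along a line in
    the plane. *)
Lemma is_derive_along_line (D : R -> R -> Prop) (f : R -> R -> R) (t x al be : R) :
  open2 D -> smooth_on D f -> D t x ->
  is_derive (fun e => f (t + e * al) (x + e * be)) 0 (dt f t x * al + dx f t x * be).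
Proof.
  intros HD Hf Hx.
  assert (Hdiff : differentiable_pt_lim f t x (dt f t x) (dx f t x)).
  { apply filterdiff_differentiable_pt_lim.
    apply (is_derive_filterdiff f t x (dt f) (dx f t x)).
    - apply locally_2d_locally
        with (P := fun s y => is_derive (fun z => f z y) s (dt f s y)).
      destruct (HD t x Hx) as [d Hd]; exists d; intros s y Hs Hy.
      exact (Derive_correct _ _ (smooth_ex_dt D f s y Hf (Hd s y Hs Hy))).
    - exact (Derive_correct _ _ (smooth_ex_dx D f t x Hf Hx)).
    - apply continuity_2d_pt_filterlim.
      exact (smooth_continuity D (dt f) t x (smooth_dt D f Hf) Hx). }
  apply is_derive_Reals.
  apply (derivable_pt_lim_comp_2d f (fun e => t + e * al) (fun e => x + e * be)).
  - rewrite !Rmult_0_l, !Rplus_0_r; exact Hdiff.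
  - apply is_derive_Reals; auto_derive; [exact I | ring].
  - apply is_derive_Reals; auto_derive; [exact I | ring].
Qed.

Definition Lop (A B C f : R -> R -> R) : R -> R -> R :=
  fun t x => dt f t x - (A t x * dx (dx f) t x + B t x * dx f t x + C t x * f t x).

(** This is [tau D_t + xi D_x] applied to [Lop A B C f], with [tau] and [xi] frozen at the point and
    mixed derivatives in the order in which [prolong] produces them. *)
Definition Lop_drift (A B C : R -> R -> R) (tau xi : R) (f : R -> R -> R) (t x : R) : R :=
  tau * (dt (dt f) t x
    - (dt A t x * dx (dx f) t x + A t x * dt (dx (dx f)) t x
       + dt B t x * dx f t x + B t x * dt (dx f) t x
       + dt C t x * f t x + C t x * dt f t x))
  + xi * (dt (dx f) t x
    - (dx A t x * dx (dx f) t x + A t x * dx (dx (dx f)) t x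
       + dx B t x * dx f t x + B t x * dx (dx f) t x
       + dx C t x * f t x + C t x * dx f t x)).

(* The prolongation formula pr X = (evolutionary part) + tau D_t + xi D_x. *)
Lemma is_derive_uncoupled (D : R -> R -> Prop) (I : Type) (A B C : R -> R -> R)
    (X : vfield I) (w : I -> R -> R -> R) (t x : R) (i : I) :
  open2 D -> smooth_on D A -> smooth_on D B -> smooth_on D C -> D t x ->
  is_derive (fun e => uncoupled A B C i (jet_shift (jet w t x) e (prolong X w t x))) 0
    (Lop A B C (characteristic X w i) t x
     + Lop_drift A B C (along w (vt X) t x) (along w (vx X) t x) (w i) t x).
Proof.
  intros HD HA HB HC Hx.
  unfold uncoupled, jet_shift, jet, prolong;
    cbv beta iota zeta delta [jt jx jw jw_t jw_x jw_xx].
  set (q := characteristic X w i).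
  set (a := along w (vt X) t x); set (b := along w (vx X) t x).
  assert (Hw : along w (vw X i) t x = q t x + a * dt (w i) t x + b * dx (w i) t x)
    by (unfold q, characteristic, a, b; ring).
  rewrite Hw; clear Hw.
  set (fA := fun e => A (t + e * a) (x + e * b)).
  assert (LA : is_derive fA 0 (dt A t x * a + dx A t x * b))
    by exact (is_derive_along_line D A t x a b HD HA Hx).
  set (fB := fun e => B (t + e * a) (x + e * b)).
  assert (LB : is_derive fB 0 (dt B t x * a + dx B t x * b))
    by exact (is_derive_along_line D B t x a b HD HB Hx).
  set (fC := fun e => C (t + e * a) (x + e * b)).
  assert (LC : is_derive fC 0 (dt C t x * a + dx C t x * b))
    by exact (is_derive_along_line D C t x a b HD HC Hx).
  assert (EA : fA 0 = A t x) by (unfold fA; now rewrite !Rmult_0_l, !Rplus_0_r).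
  assert (EB : fB 0 = B t x) by (unfold fB; now rewrite !Rmult_0_l, !Rplus_0_r).
  assert (EC : fC 0 = C t x) by (unfold fC; now rewrite !Rmult_0_l, !Rplus_0_r).
  apply is_derive_ext with (fun e =>
    dt (w i) t x + e * (dt q t x + a * dt (dt (w i)) t x + b * dt (dx (w i)) t x)
    - (fA e * (dx (dx (w i)) t x + e * (dx (dx q) t x + a * dt (dx (dx (w i))) t x
                                        + b * dx (dx (dx (w i))) t x))
       + fB e * (dx (w i) t x + e * (dx q t x + a * dt (dx (w i)) t x
                                     + b * dx (dx (w i)) t x))
       + fC e * (w i t x + e * (q t x + a * dt (w i) t x + b * dx (w i) t x)))).
  { reflexivity. }
  clearbody fA fB fC q.
  auto_derive.
  - repeat split; eexists; eassumption.
  - change (fun y : R => fA y) with fA; change (fun y : R => fB y) with fB;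
      change (fun y : R => fC y) with fC.
    rewrite (is_derive_unique fA _ _ LA), (is_derive_unique fB _ _ LB),
      (is_derive_unique fC _ _ LC), EA, EB, EC.
    unfold Lop, Lop_drift; ring.
Qed.

Lemma Lop_plus (U : R -> R -> Prop) (A B C f h : R -> R -> R) (t x : R) :
  open2 U -> smooth_on U f -> smooth_on U h -> U t x ->
  Lop A B C (fun s y => f s y + h s y) t x = Lop A B C f t x + Lop A B C h t x.
Proof.
  intros HU Hf Hh Hx.
  assert (Et : dt (fun s y => f s y + h s y) t x = dt f t x + dt h t x)
    by exact (Derive_plus (fun s => f s x) (fun s => h s x) t
                (smooth_ex_dt U f t x Hf Hx) (smooth_ex_dt U h t x Hh Hx)).
  assert (Ex : forall f h s y, smooth_on U f -> smooth_on U h -> U s y ->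
            dx (fun s y => f s y + h s y) s y = dx f s y + dx h s y)
    by (intros f' h' s y Hf' Hh' Hs;
        exact (Derive_plus (fun y => f' s y) (fun y => h' s y) y
                (smooth_ex_dx U f' s y Hf' Hs) (smooth_ex_dx U h' s y Hh' Hs))).
  unfold Lop; rewrite Et, (Ex f h t x Hf Hh Hx).
  rewrite (dx_ext_on U _ (fun s y => dx f s y + dx h s y) HU) by auto.
  rewrite Ex by auto using smooth_dx.
  ring.
Qed.

Lemma Lop_scal (A B C f : R -> R -> R) (c t x : R) :
  Lop A B C (fun s y => c * f s y) t x = c * Lop A B C f t x.
Proof.
  assert (Ex : forall f s y, dx (fun s y => c * f s y) s y = c * dx f s y)
    by (intros f' s y; exact (Derive_scal (fun z => f' s z) c y)).
  assert (Et : dt (fun s y => c * f s y) t x = c * dt f t x)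
    by exact (Derive_scal (fun z => f z x) c t).
  assert (Exx : dx (dx (fun s y => c * f s y)) t x = c * dx (dx f) t x).
  { rewrite <- Ex; apply Derive_ext; intros y; apply Ex. }
  unfold Lop; rewrite Et, Ex, Exx; ring.
Qed.

Lemma Lop_ext (U : R -> R -> Prop) (A B C f h : R -> R -> R) (t x : R) :
  open2 U -> (forall s y, U s y -> f s y = h s y) -> U t x ->
  Lop A B C f t x = Lop A B C h t x.
Proof.
  intros HU H Hx; unfold Lop.
  rewrite (dt_ext_on U f h HU H t x Hx), (dx_ext_on U f h HU H t x Hx), (H t x Hx).
  now rewrite (dx_ext_on U (dx f) (dx h) HU (dx_ext_on U f h HU H) t x Hx).
Qed.

(** The drift consists of first derivatives of an expression that vanishes identically on an open
    set. *)
Lemma Lop_drift_solution (U : R -> R -> Prop) (A B C u : R -> R -> R) (tau xi t x : R) :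
  open2 U -> smooth_on U A -> smooth_on U B -> smooth_on U C -> smooth_on U u ->
  (forall s y, U s y -> Lop A B C u s y = 0) -> U t x ->
  Lop_drift A B C tau xi u t x = 0.
Proof.
  intros HU HA HB HC Hu H Hx.
  assert (Hut : forall s y, U s y -> dt u s y
            = A s y * dx (dx u) s y + B s y * dx u s y + C s y * u s y).
  { intros s y Hs; assert (E := H s y Hs); unfold Lop in E; lra. }
  assert (Et : dt (dt u) t x = dt A t x * dx (dx u) t x + A t x * dt (dx (dx u)) t x
            + (dt B t x * dx u t x + B t x * dt (dx u) t x)
            + (dt C t x * u t x + C t x * dt u t x)).
  { rewrite (dt_ext_on U _ _ HU Hut t x Hx).
    apply is_derive_unique; auto_derive.
    - side_conditions U.
    - unfold dt, dx; ring. }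
  assert (Ex : dx (dt u) t x = dx A t x * dx (dx u) t x + A t x * dx (dx (dx u)) t x
            + (dx B t x * dx u t x + B t x * dx (dx u) t x)
            + (dx C t x * u t x + C t x * dx u t x)).
  { rewrite (dx_ext_on U _ _ HU Hut t x Hx).
    apply is_derive_unique; auto_derive.
    - side_conditions U.
    - unfold dt, dx; ring. }
  assert (Es := smooth_schwarz U u t x HU Hu Hx).
  unfold Lop_drift; rewrite Et, !Es, Ex; ring.
Qed.

(** The characteristic of [Qop] in scalar form. The argument [zeta0] is later replaced by 0 to
    isolate the linear part of the symmetry. *)
Definition Qchar (tau : R -> R) (xi zeta1 zeta0 u : R -> R -> R) : R -> R -> R :=
  fun t x => zeta1 t x * u t x + zeta0 t x - tau t * dt u t x - xi t x * dx u t x.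

Lemma Qchar_smooth (U : R -> R -> Prop) (tau : R -> R) (xi zeta1 zeta0 u : R -> R -> R) :
  open2 U -> smooth_on U (fun t _ => tau t) -> smooth_on U xi -> smooth_on U zeta1 ->
  smooth_on U zeta0 -> smooth_on U u -> smooth_on U (Qchar tau xi zeta1 zeta0 u).
Proof.
  intros HU Ht Hxi H1 H0 Hu; unfold Qchar.
  apply smooth_minus; auto.
  - apply smooth_minus; auto.
    + apply smooth_plus; auto; apply smooth_mult; auto.
    + apply (smooth_mult U (fun t _ => tau t) (dt u)); auto using smooth_dt.
  - apply smooth_mult; auto using smooth_dx.
Qed.

(** One derivative computed twice: it is 0 by the symmetry hypothesis and the stated sum by the
    prolongation formula. The function [w] satisfies the equation at the one point only, as the jets
    in [Q3op_lie_symmetry] do. *)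
Lemma lie_symmetry_criterion (D U : R -> R -> Prop) (A B C : R -> R -> R)
    (tau : R -> R) (xi zeta1 zeta0 w : R -> R -> R) (t x : R) :
  open2 D -> smooth_on D A -> smooth_on D B -> smooth_on D C ->
  lie_symmetry D (uncoupled A B C) (Qop tau xi zeta1 zeta0) ->
  open2 U -> subdom U D -> smooth_on U w -> U t x -> Lop A B C w t x = 0 ->
  Lop A B C (Qchar tau xi zeta1 zeta0 w) t x
  + Lop_drift A B C (tau t) (xi t x) w t x = 0.
Proof.
  intros HD HA HB HC HQ HU HUD Hw Hx Hs.
  assert (HQ' := HQ U (single w) HU HUD (fun _ => Hw) t x Hx (fun _ => Hs) tt).
  assert (HE := is_derive_uncoupled D unit A B C (Qop tau xi zeta1 zeta0) (single w) t x tt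
                  HD HA HB HC (HUD t x Hx)).
  exact (eq_trans (eq_sym (is_derive_unique _ _ _ HE)) (is_derive_unique _ _ _ HQ')).
Qed.

(** On a solution over an open set the drift vanishes, and the criterion leaves the equation for the
    characteristic alone. *)
Lemma Qchar_solution (D U : R -> R -> Prop) (A B C : R -> R -> R)
    (tau : R -> R) (xi zeta1 zeta0 u : R -> R -> R) :
  open2 D -> smooth_on D A -> smooth_on D B -> smooth_on D C ->
  lie_symmetry D (uncoupled A B C) (Qop tau xi zeta1 zeta0) ->
  open2 U -> subdom U D -> smooth_on U u ->
  (forall t x, U t x -> Lop A B C u t x = 0) ->
  forall t x, U t x -> Lop A B C (Qchar tau xi zeta1 zeta0 u) t x = 0.
Proof.
  intros HD HA HB HC HQ HU HUD Hu Hs t x Hx.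
  assert (E := lie_symmetry_criterion D U A B C tau xi zeta1 zeta0 u t x
                 HD HA HB HC HQ HU HUD Hu Hx (Hs t x Hx)).
  rewrite (Lop_drift_solution U A B C u) in E; eauto using smooth_sub.
  lra.
Qed.

(** The characteristic of Q on the zero solution is [zeta0]. *)
Lemma zeta0_solution (D : R -> R -> Prop) (A B C : R -> R -> R)
    (tau : R -> R) (xi zeta1 zeta0 : R -> R -> R) :
  open2 D -> smooth_on D A -> smooth_on D B -> smooth_on D C ->
  lie_symmetry D (uncoupled A B C) (Qop tau xi zeta1 zeta0) ->
  forall t x, D t x -> Lop A B C zeta0 t x = 0.
Proof.
  intros HD HA HB HC HQ t x Hx.
  assert (Zt : forall s y, dt (fun _ _ => 0) s y = 0)
    by (intros s y; exact (Derive_const 0 s)).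
  assert (Zx : forall s y, dx (fun _ _ => 0) s y = 0)
    by (intros s y; exact (Derive_const 0 y)).
  rewrite <- (Qchar_solution D D A B C tau xi zeta1 zeta0 (fun _ _ => 0)
                HD HA HB HC HQ HD (fun _ _ H => H)) with (t := t) (x := x); auto.
  - symmetry; apply (Lop_ext D); auto.
    intros s y _; unfold Qchar; rewrite Zt, Zx; ring.
  - apply smooth_const.
  - intros s y _; unfold Lop; rewrite Zt, Zx.
    assert (Zxx : dx (dx (fun _ _ => 0)) s y = 0).
    { transitivity (Derive (fun _ => 0) y); [|apply Derive_const].
      apply Derive_ext; intros z; apply Zx. }
    rewrite Zxx; ring.
Qed.

(** The characteristic on each component differs from that of Q by a combination of [zeta0], [w i1]
    and [w i2], all annihilated by [Lop] at the point, and the drift term is the same. *)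
Lemma Q3op_lie_symmetry (D U : R -> R -> Prop) (A B C : R -> R -> R)
    (tau : R -> R) (xi zeta1 zeta0 : R -> R -> R) (lam1 lam2 : idx3 -> R) :
  open2 D -> smooth_on D A -> smooth_on D B -> smooth_on D C ->
  smooth_on D (fun t _ => tau t) -> smooth_on D xi -> smooth_on D zeta1 ->
  smooth_on D zeta0 ->
  lie_symmetry D (uncoupled A B C) (Qop tau xi zeta1 zeta0) ->
  subdom U D ->
  lie_symmetry U (uncoupled A B C) (Q3op tau xi zeta1 zeta0 lam1 lam2).
Proof.
  intros HD HA HB HC Htau Hxi Hz1 Hz0 HQ HUD V w HV HVU Hw t x Hx Hs i.
  assert (HVD : subdom V D) by (intros s y H; auto).
  (* The coefficient -1 removes [zeta0] from the characteristic of Q on the first two components. *)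
  set (z := match i with i3 => 0 | _ => -1 end).
  set (q := Qchar tau xi zeta1 zeta0 (w i)).
  set (q3 := characteristic (Q3op tau xi zeta1 zeta0 lam1 lam2) w i).
  assert (HE := is_derive_uncoupled D idx3 A B C (Q3op tau xi zeta1 zeta0 lam1 lam2)
                  w t x i HD HA HB HC (HVD t x Hx)).
  assert (HL : forall k, Lop A B C (w k) t x = 0) by (intros k; exact (Hs k)).
  assert (Hq := lie_symmetry_criterion D V A B C tau xi zeta1 zeta0 (w i) t x
                  HD HA HB HC HQ HV HVD (Hw i) Hx (HL i)).
  assert (Hq3 : forall s y, q3 s y = q s y + (z * zeta0 s y
                  + (lam1 i * w i1 s y + lam2 i * w i2 s y))).
  { intros s y; unfold q3, q, z, Qchar, characteristic, along; simpl.
    destruct i; ring. }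
  assert (Sm : forall c f, smooth_on V f -> smooth_on V (fun s y => c * f s y)).
  { intros c f Hf; apply smooth_mult; auto using smooth_const. }
  assert (Sz : smooth_on V zeta0) by eauto using smooth_sub.
  assert (Sq : smooth_on V q) by (apply Qchar_smooth; eauto using smooth_sub).
  assert (E3 : Lop A B C q3 t x = Lop A B C q t x).
  { rewrite (Lop_ext V A B C q3 _ t x HV (fun s y _ => Hq3 s y) Hx).
    rewrite (Lop_plus V), (Lop_plus V), (Lop_plus V), !Lop_scal, !HL,
      (zeta0_solution D A B C tau xi zeta1 zeta0); auto using smooth_plus.
    ring. }
  change (along w (vt (Q3op tau xi zeta1 zeta0 lam1 lam2)) t x) with (tau t) in HE.
  change (along w (vx (Q3op tau xi zeta1 zeta0 lam1 lam2)) t x) with (xi t x) in HE.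
  fold q3 in HE; rewrite E3 in HE; unfold q in HE; rewrite Hq in HE.
  exact HE.
Qed.

(* With X = tau d_t + xi d_x - zeta^1 and R = d_t + g^1 d_x - g^2, invariance of
   g^1, g^2 under Q_1 says [X, R] = -tau' R, so X preserves solutions of R u = 0. *)
Lemma Qchar_invariant (U : R -> R -> Prop) (tau : R -> R) (xi zeta1 z h u : R -> R -> R)
    (g : idx3 -> R -> R -> R) :
  open2 U -> smooth_on U (fun t _ => tau t) -> smooth_on U xi -> smooth_on U zeta1 ->
  smooth_on U z -> smooth_on U h -> smooth_on U u -> (forall i, smooth_on U (g i)) ->
  (forall t x, U t x -> dt u t x + g i1 t x * dx u t x = g i2 t x * u t x + h t x) ->
  (forall t x, U t x ->
     tau t * dt (g i1) t x + xi t x * dx (g i1) t x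
     = (dx xi t x - Derive tau t) * g i1 t x + dt xi t x /\
     tau t * dt (g i2) t x + xi t x * dx (g i2) t x
     = - Derive tau t * g i2 t x + dx zeta1 t x * g i1 t x + dt zeta1 t x /\
     tau t * dt h t x + xi t x * dx h t x
     = (zeta1 t x - Derive tau t) * h t x - z t x * g i2 t x
       + dx z t x * g i1 t x + dt z t x) ->
  forall t x, U t x ->
    dt (Qchar tau xi zeta1 z u) t x + g i1 t x * dx (Qchar tau xi zeta1 z u) t x
    = g i2 t x * Qchar tau xi zeta1 z u t x.
Proof.
  intros HU Ht Hxi Hz1 Hz Hh Hu Hg HR HI t x Hx.
  assert (Hut : forall s y, U s y ->
            dt u s y = g i2 s y * u s y + h s y - g i1 s y * dx u s y).
  { intros s y Hs; assert (E := HR s y Hs); lra. }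
  assert (Et : dt (dt u) t x = dt (g i2) t x * u t x + g i2 t x * dt u t x + dt h t x
            - (dt (g i1) t x * dx u t x + g i1 t x * dt (dx u) t x)).
  { rewrite (dt_ext_on U _ _ HU Hut t x Hx).
    apply is_derive_unique; auto_derive.
    - side_conditions U.
    - unfold dt, dx; ring. }
  assert (Ex : dx (dt u) t x = dx (g i2) t x * u t x + g i2 t x * dx u t x + dx h t x
            - (dx (g i1) t x * dx u t x + g i1 t x * dx (dx u) t x)).
  { rewrite (dx_ext_on U _ _ HU Hut t x Hx).
    apply is_derive_unique; auto_derive.
    - side_conditions U.
    - unfold dt, dx; ring. }
  assert (Htau : ex_derive tau t) by exact (smooth_ex_dt U (fun t _ => tau t) t x Ht Hx).
  assert (Qt : dt (Qchar tau xi zeta1 z u) t x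
          = dt zeta1 t x * u t x + zeta1 t x * dt u t x + dt z t x
            - (Derive tau t * dt u t x + tau t * dt (dt u) t x)
            - (dt xi t x * dx u t x + xi t x * dt (dx u) t x)).
  { apply is_derive_unique; unfold Qchar; auto_derive.
    - side_conditions U.
    - unfold dt, dx; change (fun s : R => tau s) with tau; ring. }
  assert (Qx : dx (Qchar tau xi zeta1 z u) t x
          = dx zeta1 t x * u t x + zeta1 t x * dx u t x + dx z t x
            - tau t * dx (dt u) t x
            - (dx xi t x * dx u t x + xi t x * dx (dx u) t x)).
  { apply is_derive_unique; unfold Qchar; auto_derive.
    - side_conditions U.
    - unfold dt, dx; ring. }
  destruct (HI t x Hx) as [I1 [I2 I3]].
  rewrite Qt, Qx, Et, (smooth_schwarz U u t x HU Hu Hx), Ex; unfold Qchar.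
  rewrite (Hut t x Hx).
  set (u0 := u t x); set (ux := dx u t x).
  (* Solving the invariance conditions for the [t]-derivatives of [xi], [zeta1] and [z] and
     substituting them leaves a polynomial identity. *)
  assert (J1 : dt xi t x = tau t * dt (g i1) t x + xi t x * dx (g i1) t x
             - (dx xi t x - Derive tau t) * g i1 t x) by lra.
  assert (J2 : dt zeta1 t x = tau t * dt (g i2) t x + xi t x * dx (g i2) t x
             + Derive tau t * g i2 t x - dx zeta1 t x * g i1 t x) by lra.
  assert (J3 : dt z t x = tau t * dt h t x + xi t x * dx h t x
     - (zeta1 t x - Derive tau t) * h t x + z t x * g i2 t x
       - dx z t x * g i1 t x) by lra.
  rewrite J1, J2, J3; ring.
Qed.

(** * Basis of reduced solutions and the Lie invariant triple *)

Lemma wronskian_lin_indep (U : R -> R -> Prop) (f h : R -> R -> R) (t x : R) :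
  open2 U -> smooth_on U f -> smooth_on U h -> U t x ->
  f t x * dx h t x - dx f t x * h t x <> 0 -> lin_indep U f h.
Proof.
  intros HU Hf Hh Hx HW c1 c2 H.
  assert (E0 := H t x Hx).
  assert (E1 : c1 * dx f t x + c2 * dx h t x = 0).
  { transitivity (dx (fun _ _ => 0) t x); [|exact (Derive_const 0 x)].
    rewrite <- (dx_ext_on U _ _ HU H t x Hx); symmetry.
    apply is_derive_unique; auto_derive.
    - side_conditions U.
    - unfold dx; ring. }
  split.
  - apply Rmult_eq_reg_r with (f t x * dx h t x - dx f t x * h t x); auto.
    transitivity ((c1 * f t x + c2 * h t x) * dx h t x
                  - (c1 * dx f t x + c2 * dx h t x) * h t x); [ring|].
    rewrite E0, E1; ring.
  - apply Rmult_eq_reg_r with (f t x * dx h t x - dx f t x * h t x); auto.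
    transitivity ((c1 * dx f t x + c2 * dx h t x) * f t x
                  - (c1 * f t x + c2 * h t x) * dx f t x); [ring|].
    rewrite E0, E1; ring.
Qed.

(** The way back from the total system. Subtracting the last two equations recovers L. *)
Lemma reduced_solution_equations (U : R -> R -> Prop) (A B C : R -> R -> R)
    (g : idx3 -> R -> R -> R) (h u p : R -> R -> R) :
  open2 U -> (forall t x, U t x -> A t x <> 0) ->
  reduced_solution U A B C g h u p ->
  forall t x, U t x ->
    dx u t x = p t x /\
    A t x * dx (dx u) t x
    = - (B t x + g i1 t x) * dx u t x + (g i2 t x - C t x) * u t x + h t x /\
    dt u t x + g i1 t x * dx u t x = g i2 t x * u t x + h t x.
Proof.
  intros HU HA Hu t x Hx.
  destruct (total_solution_partials _ _ _ _ _ _ _ _ _ _ _ _ t x Hu Hx) as [E1 [E2 [E3 _]]].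
  assert (Exx : dx (dx u) t x = dx p t x).
  { apply (dx_ext_on U); auto; intros s y Hs.
    now destruct (total_solution_partials _ _ _ _ _ _ _ _ _ _ _ _ s y Hu Hs). }
  assert (Hnz := HA t x Hx).
  rewrite Exx, E1, E2, E3; split; [reflexivity|].
  unfold red_a, red_b, red_c, red_l; split; [field; auto | ring].
Qed.

Lemma total_solution_ext (U : R -> R -> Prop)
    (a b c k l m al be ga c' m' ga' u p : R -> R -> R) :
  (forall t x, U t x -> c t x = c' t x /\ m t x = m' t x /\ ga t x = ga' t x) ->
  total_solution U a b c k l m al be ga u p ->
  total_solution U a b c' k l m' al be ga' u p.
Proof.
  intros H Hu t x Hx; destruct (H t x Hx) as [E1 [E2 E3]].
  rewrite <- E1, <- E2, <- E3; exact (Hu t x Hx).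
Qed.

(** For [h = 0] the terms [red_c] and [red_ga] equal 0 only pointwise, through a division by [A] and
    the derivative of a constant; this lemma and the next pass between the two forms. *)
Lemma reduced_solution_0 (U : R -> R -> Prop) (A B C : R -> R -> R)
    (g : idx3 -> R -> R -> R) (u p : R -> R -> R) :
  (forall t x, U t x -> A t x <> 0) ->
  reduced_solution U A B C g (fun _ _ => 0) u p ->
  homogeneous_solution U (red_a A C g) (red_b A B g) (g i2) (red_l g)
    (red_al A C g) (red_be A B g) u p.
Proof.
  intros HA; apply total_solution_ext; intros t x Hx; specialize (HA t x Hx).
  assert (E : dx (fun _ _ => 0) t x = 0) by exact (Derive_const 0 x).
  unfold red_ga, red_c; rewrite E; split; [|split]; auto; field; auto.
Qed.

Lemma homogeneous_reduced_solution (U : R -> R -> Prop) (A B C : R -> R -> R)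
    (g : idx3 -> R -> R -> R) (u p : R -> R -> R) :
  (forall t x, U t x -> A t x <> 0) ->
  homogeneous_solution U (red_a A C g) (red_b A B g) (g i2) (red_l g)
    (red_al A C g) (red_be A B g) u p ->
  reduced_solution U A B C g (fun _ _ => 0) u p.
Proof.
  intros HA; apply total_solution_ext; intros t x Hx; specialize (HA t x Hx).
  assert (E : dx (fun _ _ => 0) t x = 0) by exact (Derive_const 0 x).
  unfold red_ga, red_c; rewrite E; split; [|split]; auto; field; auto.
Qed.

Lemma compatible_homogeneous (U : R -> R -> Prop) (a b c k l m al be ga : R -> R -> R) :
  compatible_on U a b c k l m al be ga ->
  compatible_on U a b (fun _ _ => 0) k l (fun _ _ => 0) al be (fun _ _ => 0).
Proof.
  intros H t x Hx; destruct (H t x Hx) as [H1 [H2 [_ [H4 [H5 _]]]]].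
  assert (Ex : dx (fun _ _ => 0) t x = 0) by exact (Derive_const 0 x).
  assert (Et : dt (fun _ _ => 0) t x = 0) by exact (Derive_const 0 t).
  rewrite Ex, Et; repeat split; auto; ring.
Qed.

Lemma reduced_solution_exists (D : R -> R -> Prop) (A B C : R -> R -> R)
    (g : idx3 -> R -> R -> R) (t0 x0 : R) :
  open2 D -> smooth_on D A -> smooth_on D B -> smooth_on D C ->
  (forall t x, D t x -> A t x <> 0) -> (forall i, smooth_on D (g i)) ->
  solves D (DE1 A B C) g -> D t0 x0 ->
  exists r, 0 < r /\ subdom (box t0 x0 r) D /\
  exists v p : idx3 -> R -> R -> R,
    (forall i, smooth_on (box t0 x0 r) (v i)) /\
    (forall i, reduced_solution (box t0 x0 r) A B C g
       (match i with i3 => g i3 | _ => fun _ _ => 0 end) (v i) (p i)) /\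
    (forall t x, box t0 x0 r t x ->
       v i1 t x * dx (v i2) t x - dx (v i1) t x * v i2 t x <> 0).
Proof.
  intros HD HA HB HC HA0 Hg HDE Hx0.
  assert (Hcomp := DE1_compatible D A B C g HD HA HB HC HA0 Hg HDE).
  assert (Sa : smooth_on D (red_a A C g))
    by (apply smooth_div; auto; apply smooth_minus; auto).
  assert (Sb : smooth_on D (red_b A B g))
    by (apply smooth_div; auto; apply smooth_opp; auto; apply smooth_plus; auto).
  assert (Sc : smooth_on D (red_c A (g i3))) by (apply smooth_div; auto).
  assert (Sl : smooth_on D (red_l g)) by (apply smooth_opp; auto).
  assert (Sal : smooth_on D (red_al A C g)).
  { apply smooth_plus; auto using smooth_dx; apply smooth_mult; auto. }
  assert (Sbe : smooth_on D (red_be A B g)).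
  { apply smooth_plus; auto; [|apply smooth_mult; auto].
    apply smooth_plus; auto using smooth_dx. }
  assert (Sga : smooth_on D (red_ga A g (g i3))).
  { apply smooth_plus; auto using smooth_dx; apply smooth_mult; auto. }
  destruct (smooth_frobenius D t0 x0 _ _ _ _ _ _ _ _ _ HD Hx0
              Sa Sb Sc (Hg i2) Sl (Hg i3) Sal Sbe Sga Hcomp) as [ra [Hra [HraD Ha]]].
  assert (S0 := smooth_const D 0).
  destruct (smooth_frobenius D t0 x0 _ _ _ _ _ _ _ _ _ HD Hx0
              Sa Sb S0 (Hg i2) Sl S0 Sal Sbe S0 (compatible_homogeneous _ _ _ _ _ _ _ _ _ _ Hcomp))
    as [rh [Hrh [HrhD Hh]]].
  (* Initial values (1,0) and (0,1) make the Wronskian equal to 1 at the centre, so it is nonzero on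
     a smaller box. For the third function any particular solution serves. *)
  destruct (Hh 1 0) as [v1 [p1 [V1 [P1 [T1 [S1 SP1]]]]]].
  destruct (Hh 0 1) as [v2 [p2 [V2 [P2 [T2 [S2 SP2]]]]]].
  destruct (Ha 0 0) as [v3 [p3 [_ [_ [T3 [S3 _]]]]]].
  assert (HW : continuity_2d_pt (fun t x => v1 t x * p2 t x - p1 t x * v2 t x) t0 x0).
  { apply (smooth_continuity (box t0 x0 rh)).
    - apply smooth_minus; auto using box_open; apply smooth_mult; auto using box_open.
    - split; rewrite Rminus_diag, Rabs_R0; auto. }
  apply continuity_2d_pt_neq_0 in HW; [|rewrite V1, P2, P1, V2; lra].
  destruct HW as [rw HW].
  set (r := Rmin (Rmin ra rh) rw).
  assert (Hr : 0 < r) by (repeat apply Rmin_pos; auto; apply cond_pos).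
  assert (R1 : r <= ra) by (eapply Rle_trans; [apply Rmin_l | apply Rmin_l]).
  assert (R2 : r <= rh) by (eapply Rle_trans; [apply Rmin_l | apply Rmin_r]).
  assert (R3 : r <= rw) by apply Rmin_r.
  assert (Ua : subdom (box t0 x0 r) (box t0 x0 ra)) by (intros t x [H1 H2]; split; lra).
  assert (Uh : subdom (box t0 x0 r) (box t0 x0 rh)) by (intros t x [H1 H2]; split; lra).
  assert (UD : subdom (box t0 x0 r) D) by (intros t x H; auto).
  exists r; split; [auto|]; split; [auto|].
  exists (fun i => match i with i1 => v1 | i2 => v2 | i3 => v3 end),
    (fun i => match i with i1 => p1 | i2 => p2 | i3 => p3 end).
  split; [|split].
  - intros [| |]; eauto using smooth_sub.
  - intros [| |].
    + apply homogeneous_reduced_solution; auto; intros t x Hx; exact (T1 t x (Uh t x Hx)).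
    + apply homogeneous_reduced_solution; auto; intros t x Hx; exact (T2 t x (Uh t x Hx)).
    + intros t x Hx; exact (T3 t x (Ua t x Hx)).
  - intros t x Hx.
    destruct (total_solution_partials _ _ _ _ _ _ _ _ _ _ _ _ t x T1 (Uh t x Hx)) as [E1 _].
    destruct (total_solution_partials _ _ _ _ _ _ _ _ _ _ _ _ t x T2 (Uh t x Hx)) as [E2 _].
    rewrite E1, E2; destruct Hx; apply HW; lra.
Qed.

Theorem proposition1 :
  forall (D : R -> R -> Prop) (A B C : R -> R -> R)
    (tau : R -> R) (xi zeta1 zeta0 : R -> R -> R) (g : idx3 -> R -> R -> R),
  open2 D ->
  analytic_on D A -> analytic_on D B -> analytic_on D C ->
  (forall t x, D t x -> A t x <> 0) ->
  smooth_on D (fun t _ => tau t) ->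
  smooth_on D xi -> smooth_on D zeta1 -> smooth_on D zeta0 ->
  lie_symmetry D (uncoupled A B C) (Qop tau xi zeta1 zeta0) ->
  (forall t x, D t x -> tau t <> 0) ->
  (forall i, smooth_on D (g i)) ->
  solves D (DE1 A B C) g ->
  invariant D (Q1op tau xi zeta1 zeta0) g ->
  forall t0 x0, D t0 x0 ->
  exists r : R, 0 < r /\ subdom (box t0 x0 r) D /\
  exists (v : idx3 -> R -> R -> R) (lam1 lam2 : idx3 -> R),
    (forall i, smooth_on (box t0 x0 r) (v i)) /\
    solves (box t0 x0 r) (uncoupled A B C) v /\
    lin_indep (box t0 x0 r) (v i1) (v i2) /\
    lie_symmetry (box t0 x0 r) (uncoupled A B C)
      (Q3op tau xi zeta1 zeta0 lam1 lam2) /\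
    invariant (box t0 x0 r) (Q3op tau xi zeta1 zeta0 lam1 lam2) v /\
    (forall t x, box t0 x0 r t x ->
       let a := A t x in
       let v1 := v i1 t x in
       let v2 := v i2 t x in
       let v3 := v i3 t x in
       let v1x := dx (v i1) t x in
       let v2x := dx (v i2) t x in
       let v3x := dx (v i3) t x in
       let v1xx := dx (dx (v i1)) t x in
       let v2xx := dx (dx (v i2)) t x in
       let v3xx := dx (dx (v i3)) t x in
       let W := v1 * v2x - v1x * v2 in
       W <> 0 /\
       g i1 t x = - a * ((v1 * v2xx - v1xx * v2) / W) - B t x /\
       g i2 t x = - a * ((v1x * v2xx - v1xx * v2x) / W) + C t x /\
       g i3 t x = a / W * det3 v1 v1x v1xx v2 v2x v2xx v3 v3x v3xx) /\
    (forall (s y rho : R) (u : R -> R -> R),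
       0 < rho -> subdom (box s y rho) (box t0 x0 r) ->
       smooth_on (box s y rho) u ->
       solves (box s y rho) (uncoupled A B C) (single u) ->
       invariant (box s y rho) (Rop g) (single u) ->
       exists c1 c2 : R, forall t x, box s y rho t x ->
         u t x = c1 * v i1 t x + c2 * v i2 t x + v i3 t x).
Proof.
  intros D A B C tau xi zeta1 zeta0 g HD HA HB HC HA0 Htau Hxi Hz1 Hz0 HQ _ Hg HDE HI
    t0 x0 Hx0.
  apply proj1 in HA; apply proj1 in HB; apply proj1 in HC.
  destruct (reduced_solution_exists D A B C g t0 x0 HD HA HB HC HA0 Hg HDE Hx0)
    as [r [Hr [HUD [v [p [Hv [Hred HW]]]]]]].
  set (U := box t0 x0 r) in *.
  assert (HU : open2 U) by apply box_open.
  assert (HAU : forall t x, U t x -> A t x <> 0) by auto.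
  (* [h i] is the free term in the invariance condition of [v i], and [z i] is the free term of the
     symmetry acting on it: [g i3] and [zeta0] for the third component, zero for the others. *)
  set (h := fun i : idx3 => match i with i3 => g i3 | _ => fun _ _ => 0 end) in *.
  set (z := fun i : idx3 => match i with i3 => zeta0 | _ => fun _ _ => 0 end).
  assert (Heq := fun i => reduced_solution_equations U A B C g (h i) (v i) (p i)
                            HU HAU (Hred i)).
  assert (HL : forall i t x, U t x -> Lop A B C (v i) t x = 0).
  { intros i t x Hx; destruct (Heq i t x Hx) as [_ [E2 E3]]; unfold Lop; lra. }
  assert (Hsub : forall f, smooth_on D f -> smooth_on U f)
    by (intros f Hf; now apply smooth_sub with D).
  assert (Hh : forall i, smooth_on U (h i))
    by (intros [| |]; simpl; auto using smooth_const).
  assert (Hz : forall i, smooth_on U (z i))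
    by (intros [| |]; simpl; auto using smooth_const).
  (* For the first two components [zeta0] is subtracted from the characteristic, which is allowed
     because [zeta0] solves L. *)
  assert (HzL : forall i t x, U t x -> Lop A B C (Qchar tau xi zeta1 (z i) (v i)) t x = 0).
  { intros i t x Hx.
    assert (E := Qchar_solution D U A B C tau xi zeta1 zeta0 (v i) HD HA HB HC HQ HU HUD
                   (Hv i) (HL i) t x Hx).
    assert (E0 : Lop A B C (Qchar tau xi zeta1 (fun _ _ => 0) (v i)) t x = 0).
    { rewrite (Lop_ext U A B C _
        (fun s y => Qchar tau xi zeta1 zeta0 (v i) s y + (-1) * zeta0 s y) t x HU); auto.
      - rewrite (Lop_plus U), Lop_scal, E, (zeta0_solution D A B C tau xi zeta1 zeta0);
          auto using smooth_mult, smooth_const, Qchar_smooth; ring.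
      - intros s y _; unfold Qchar; ring. }
    destruct i; [exact E0 | exact E0 | exact E]. }
  assert (Hfun0 : forall t x, dt (fun _ _ => 0) t x = 0 /\ dx (fun _ _ => 0) t x = 0)
    by (intros t x; split; [exact (Derive_const 0 t) | exact (Derive_const 0 x)]).
  (* The third invariance condition is that of [g i3] for the third component and [0 = 0] for the
     others. *)
  assert (HzR : forall i t x, U t x ->
            dt (Qchar tau xi zeta1 (z i) (v i)) t x
            + g i1 t x * dx (Qchar tau xi zeta1 (z i) (v i)) t x
            = g i2 t x * Qchar tau xi zeta1 (z i) (v i) t x).
  { intros i; apply Qchar_invariant with (h := h i); auto.
    - intros t x Hx; now destruct (Heq i t x Hx) as [_ [_ E]].
    - intros t x Hx.
      assert (I1 := HI t x (HUD t x Hx) i1); assert (I2 := HI t x (HUD t x Hx) i2);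
        assert (I3 := HI t x (HUD t x Hx) i3).
      unfold along, Q1op in I1, I2, I3; simpl in I1, I2, I3.
      split; [exact I1|]; split; [exact I2|].
      destruct i; simpl; [| |exact I3];
        destruct (Hfun0 t x) as [Z1 Z2]; rewrite Z1, Z2; ring. }
  assert (Hhom : forall i, (match i with i3 => False | _ => True end) ->
            homogeneous_solution U (red_a A C g) (red_b A B g) (g i2) (red_l g)
              (red_al A C g) (red_be A B g) (v i) (p i)).
  { intros [| |] Hi; try contradiction; apply reduced_solution_0 with (C := C); auto;
      [exact (Hred i1) | exact (Hred i2)]. }
  assert (HWp : forall t x, U t x -> v i1 t x * p i2 t x - p i1 t x * v i2 t x <> 0).
  { intros t x Hx; destruct (Heq i1 t x Hx) as [E1 _]; destruct (Heq i2 t x Hx) as [E2 _].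
    rewrite <- E1, <- E2; auto. }
  (* Each characteristic solves L and the homogeneous invariance condition, hence the homogeneous
     total system. *)
  assert (Hspan : forall i, exists c : R * R, forall t x, U t x ->
            Qchar tau xi zeta1 (z i) (v i) t x = fst c * v i1 t x + snd c * v i2 t x).
  { intros i.
    destruct (homogeneous_span t0 x0 r (red_a A C g) (red_b A B g) (g i2) (red_l g)
                (red_al A C g) (red_be A B g) (Qchar tau xi zeta1 (z i) (v i))
                (dx (Qchar tau xi zeta1 (z i) (v i))) (v i1) (p i1) (v i2) (p i2))
      as [c1 [c2 Hc]]; auto.
    - apply reduced_solution_0 with (C := C); auto.
      apply reduced_solution_of_invariant; auto using smooth_const, Qchar_smooth.
      + intros t x Hx; assert (E := HzL i t x Hx); unfold Lop in E; lra.
      + intros t x Hx; rewrite Rplus_0_r; now apply HzR.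
    - exists (c1, c2); exact Hc. }
  set (lam := fun i => proj1_sig (constructive_indefinite_description _ (Hspan i))).
  assert (Hlam : forall i t x, U t x -> Qchar tau xi zeta1 (z i) (v i) t x
            = fst (lam i) * v i1 t x + snd (lam i) * v i2 t x).
  { intros i; exact (proj2_sig (constructive_indefinite_description _ (Hspan i))). }
  clearbody lam.
  exists r; split; [auto|]; split; [auto|].
  (* Invariance under [Q3op] means that the characteristic plus the lambda terms vanishes, hence the
     minus signs. *)
  exists v, (fun i => - fst (lam i)), (fun i => - snd (lam i)).
  split; [auto|]; split; [|split; [|split; [|split; [|split]]]].
  - intros t x Hx i; exact (HL i t x Hx).
  - assert (Hc : U t0 x0) by (split; rewrite Rminus_diag, Rabs_R0; auto).
    apply wronskian_lin_indep with t0 x0; auto.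
  - apply Q3op_lie_symmetry with D; auto.
  - intros t x Hx i; assert (E := Hlam i t x Hx).
    unfold along, Q3op, Qchar in *; destruct i; simpl in E |- *; lra.
  - intros t x Hx a v1 v2 v3 v1x v2x v3x v1xx v2xx v3xx W.
    assert (HWx : W <> 0) by exact (HW t x Hx).
    destruct (Heq i1 t x Hx) as [_ [E1 _]]; destruct (Heq i2 t x Hx) as [_ [E2 _]];
      destruct (Heq i3 t x Hx) as [_ [E3 _]]; simpl in E1, E2, E3.
    fold a v1 v1x v1xx in E1; fold a v2 v2x v2xx in E2; fold a v3 v3x v3xx in E3.
    split; [exact HWx|]; split; [|split].
    (* The column of [A v^i_xx] is [-(B + g^1)] times the column of [v^i_x], plus [g^2 - C] times
       the column of [v^i], plus (0, 0, g^3). Hence each determinant in the formulas is a multiple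
       of [W]. *)
    + apply Rmult_eq_reg_r with W; auto.
      transitivity (- (v1 * (a * v2xx) - (a * v1xx) * v2) - B t x * W);
        [rewrite E1, E2; unfold W; ring | field; auto].
    + apply Rmult_eq_reg_r with W; auto.
      transitivity (- (v1x * (a * v2xx) - (a * v1xx) * v2x) + C t x * W);
        [rewrite E1, E2; unfold W; ring | field; auto].
    + apply Rmult_eq_reg_r with W; auto.
      transitivity (det3 v1 v1x (a * v1xx) v2 v2x (a * v2xx) v3 v3x (a * v3xx));
        [rewrite E1, E2, E3; unfold det3, W; ring | unfold det3; field; auto].
  - intros s y rho u Hrho HVU Hu HuL HuR.
    set (V := box s y rho) in *.
    assert (HVD : subdom V D) by (intros t x Hx; exact (HUD t x (HVU t x Hx))).
    assert (Hured : reduced_solution V A B C g (g i3) u (dx u)).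
    { apply reduced_solution_of_invariant; eauto using smooth_sub, box_open.
      - intros t x Hx; assert (E := HuL t x Hx tt); unfold uncoupled, jet, single in E;
          simpl in E; lra.
      - intros t x Hx; assert (E := HuR t x Hx tt); unfold along, Rop, single in E;
          simpl in E; lra. }
    (* The difference [u - v^3] solves the homogeneous system; the span lemma is applied on the box
       of [u], where its constants live. *)
    destruct (homogeneous_span s y rho (red_a A C g) (red_b A B g) (g i2) (red_l g)
                (red_al A C g) (red_be A B g) (fun t x => u t x - v i3 t x)
                (fun t x => dx u t x - p i3 t x) (v i1) (p i1) (v i2) (p i2))
      as [c1 [c2 Hc]].
    + apply (total_solution_minus _ _ _ _ _ _ _ _ _ _ _ _ _ _ Hured).
      intros t x Hx; exact (Hred i3 t x (HVU t x Hx)).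
    + intros t x Hx; exact (Hhom i1 I t x (HVU t x Hx)).
    + intros t x Hx; exact (Hhom i2 I t x (HVU t x Hx)).
    + intros t x Hx; exact (HWp t x (HVU t x Hx)).
    + exists c1, c2; intros t x Hx; specialize (Hc t x Hx); simpl in Hc; lra.
Qed.
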